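(* For any $n$-point $\ell_p$ normed space $(X,d_X)$ with $p\in(1,2]$ and any $t\geq 2$, there is an $O(t)$-spanner for $(X,d_X)$ with lightness $O\!\left(t\, n^{\frac{\log^2 t}{t^p}}\log n\right)$.
   Context: A $t$-spanner for a finite metric space $(X,d_X)$ is a subgraph $H$ of the complete graph on $X$ with edge weights $w(x,y)=d_X(x,y)$, such that $d_H(x,y)\leq t\cdot d_X(x,y)$ for all $x,y\in X$. Its lightness is $w(H)/w(\mathrm{MST})$, where $\mathrm{MST}$ is a minimum spanning tree of that complete weighted graph. An $n$-point $\ell_p$ normed space is an $n$-point subset of some $\mathbb{R}^D$ with the metric induced by the $\ell_p$ norm. *)

(* Defs.v *)
From HB Require Import structures.
From mathcomp Require Import all_boot all_order all_algebra.
From mathcomp Require Import finmap.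
From mathcomp Require Import classical_sets reals ereal exp.

Set Implicit Arguments.
Unset Strict Implicit.
Unset Printing Implicit Defensive.

Import Order.TTheory GRing.Theory Num.Theory.

Local Open Scope ring_scope.

Section Graphs.
Variables (R : realType) (V : finType).

(* A subgraph of the complete graph on V, with vertex set all of V. *)
Record graph := Graph {
  adj :> rel V ;
  adj_sym : symmetric adj ;
  adj_irrefl : irreflexive adj }.

(* Edge weights: the edge {x, y} has weight d x y, with d symmetric. *)
Variable d : V -> V -> R.

(* Each undirected edge occurs twice in the double sum. *)
Definition weight (G : graph) : R :=
  (\sum_(x : V) \sum_(y : V | adj G x y) d x y) / 2.

Fixpoint walk_weight (x : V) (s : seq V) : R :=
  if s is y :: s' then d x y + walk_weight y s' else 0.

(* Equal to +oo when no walk of G joins x to y. *)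
Definition graph_dist (G : graph) (x y : V) : \bar R :=
  ereal_inf [set (walk_weight x s)%:E | s in
    [set s : seq V | path (adj G) x s /\ last x s = y]]%classic.

Definition is_spanner (t : R) (H : graph) : Prop :=
  forall x y : V, (graph_dist H x y <= (t * d x y)%:E)%E.

(* In a symmetric irreflexive relation, the duplicate-free closed walks of
   size at most 2 are the empty one and single edges run back and forth. *)
Definition acyclic (G : graph) : Prop :=
  forall c : seq V, ucycle (adj G) c -> (size c <= 2)%N.

Definition spanning_tree (T : graph) : Prop :=
  (forall x y : V, connect (adj T) x y) /\ acyclic T.

Definition is_mst (T : graph) : Prop :=
  spanning_tree T /\
  forall T' : graph, spanning_tree T' -> weight T <= weight T'.

End Graphs.

Definition lp_norm (R : realType) (p : R) (D : nat) (x : 'rV[R]_D) : R :=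
  (\sum_(i < D) `|x 0 i| `^ p) `^ p^-1.

Definition lp_dist (R : realType) (p : R) (D : nat) (X : {fset 'rV[R]_D})
    (x y : X) : R :=
  lp_norm p (fsval x - fsval y).

(* Main.v *)
(* The spanner consists of a minimum spanning tree T, of additional chords
   weighing at most as much as T, and of stars on clusters of nets P_j, one net
   for each scale th_j = 33^j th_0.

   The nets are amortized against the weight of a rooted tree, initially T, on a
   shrinking set of points. At scale th, dropping the branches of radius less
   than 2 th saves th for each leaf of the remaining tree. Suppose that two
   points at distance at most th are still more than 10 th apart in the current
   graph, and that the tree is, up to distance 6 th around one of them, a path
   without branching points, leaves or edges of length th. Adding this pair as a
   chord of length at most 5 th closes a cycle through one of the two halves of
   the path, which can be replaced by one edge and then removed, so the tree
   loses at least th. Hence th_j |P_j| is bounded by the loss of weight at the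
   j-th scale, up to the long edges of T, and the sum over j is O(w(T)); every
   pair at distance about th_j is either already well served or lies near P_j.

   For points of P_j at distance at most r, clusters of diameter O(t r) are
   needed. For 1 <= p <= 2 the function |u|^p is comparable to a positive
   combination of 1 - cos (la_k u) over dyadic frequencies. Products of factors
   1 +- al cos (la u) and 1 +- al sin (la u) are nonnegative, and their
   correlations multiply into a kernel between exp (- C s |x - y|_p^p) and
   exp (- c s |x - y|_p^p). For a suitable s the kernel is negligible at
   distance O(t r) and at least a small power of 1/n at distance r, so some
   level set of one of these products, without its points having a far partner
   in it, contains a proportional share of the close pairs. Repeating this
   greedily covers all of them. *)
Require Import Defs.
From HB Require Import structures.
From mathcomp Require Import boolp classical_sets reals ereal sequences realfun derive.
From mathcomp Require Import topology normedtype exp trigo interval_inference convex hoelder.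
From mathcomp Require Import all_boot all_order all_algebra.
From mathcomp Require Import finmap.
From mathcomp Require Import zify ring lra.

Set Implicit Arguments.
Unset Strict Implicit.
Unset Printing Implicit Defensive.

Import Order.TTheory GRing.Theory Num.Theory.
Import numFieldNormedType.Exports.

Local Open Scope ring_scope.

(** * Rooted trees *)

Definition pmetric (R : realFieldType) (V : Type) (d : V -> V -> R) : Prop :=
  [/\ forall x, d x x = 0, forall x y, d x y = d y x &
      forall x y z, d x z <= d x y + d y z].

Lemma pmetric_ge0 (R : realFieldType) (V : Type) (d : V -> V -> R) (x y : V) :
  pmetric d -> 0 <= d x y.
Proof.
move=> [d0 ds dt]; have := dt x y x; rewrite d0 (ds y x).
by move=> ?; lra.
Qed.

Lemma ler_sum_sub (R : realFieldType) (V : finType) (P Q : pred V) (f : V -> R) :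
  (forall v, P v -> Q v) -> (forall v, 0 <= f v) ->
  \sum_(v | P v) f v <= \sum_(v | Q v) f v.
Proof.
move=> PQ f0; rewrite [leRHS](bigID P) /= [X in _ <= X + _](eq_bigl P).
  by rewrite lerDl sumr_ge0.
by move=> v; rewrite andbC; case Pv: (P v) => //=; rewrite PQ.
Qed.

Lemma ler_sum_disjoint (R : realFieldType) (V : finType) (I : {set V})
    (N : V -> {set V}) (M : {set V}) (f : V -> R) :
  (forall v, 0 <= f v) -> (forall s, s \in I -> N s \subset M) ->
  (forall s s' v, s \in I -> s' \in I -> v \in N s -> v \in N s' -> s = s') ->
  \sum_(s in I) \sum_(v in N s) f v <= \sum_(v in M) f v.
Proof.
move=> f0 NM disj; rewrite (exchange_big_dep (mem M)) /=; last first.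
  by move=> s v sI; exact: (subsetP (NM s sI)).
apply: ler_sum => v vM; have [s /andP[sI vs]|none] := pickP (fun s => (s \in I) && (v \in N s)).
  rewrite (big_pred1 s) // => s'; apply/idP/eqP => [/andP[s'I vs']|->].
    exact: disj vs' vs.
  by rewrite sI.
by rewrite big_pred0.
Qed.

(** The root is a fixed point of [par], and reaching it from every point excludes other cycles.
    Nothing is asked of [par] outside [W], so a subtree can keep the same parent map. *)
Definition rooted_tree (V : finType) (W : {set V}) (rt : V) (par : V -> V) :
    Prop :=
  [/\ rt \in W, par rt = rt, forall v, v \in W -> par v \in W &
      forall v, v \in W -> fconnect par v rt].

Section RootedTree.
Variables (V : finType) (W : {set V}) (rt : V) (par : V -> V).
Hypothesis T : rooted_tree W rt par.

Let depth v := findex par v rt.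

Lemma fconnect_mem u v : fconnect par u v -> u \in W -> v \in W.
Proof.
case: T => _ _ Wpar _ /iter_findex <-; elim: (findex _ _ _) => //= k IH uW.
exact/Wpar/IH.
Qed.

Lemma fconnect_rt v : fconnect par rt v -> v = rt.
Proof.
case: T => _ prt _ _ /iter_findex <-.
by elim: (findex _ _ _) => //= k ->.
Qed.

Lemma depth_par v : v \in W -> v != rt -> depth v = (depth (par v)).+1.
Proof. by case: T => _ _ _ con vW vrt; rewrite /depth fconnect_findex ?con // eq_sym. Qed.

Lemma fconnect_depth u v :
  u \in W -> fconnect par u v -> u != v -> (depth v < depth u)%N.
Proof.
move=> uW /iter_findex; move: (findex _ _ _) => k.
elim: k u uW => [|k IH] u uW; first by move=> /= -> /eqP.
rewrite iterSr => ek uv.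
have urt : u != rt.
  apply: contra uv => /eqP eu; rewrite eu.
  have : fconnect par rt v by rewrite -ek -iterSr eu fconnect_iter.
  by move/fconnect_rt->.
have [_ _ Wpar _] := T.
rewrite (depth_par uW urt) ltnS; have [<-|pv] := eqVneq (par u) v; first by [].
by apply: ltnW; apply: IH => //; exact: Wpar.
Qed.

Lemma fconnect_anti u v :
  u \in W -> fconnect par u v -> fconnect par v u -> u = v.
Proof.
move=> uW uv vu; apply/eqP/negPn/negP => nuv.
have := fconnect_depth uW uv nuv.
have vW := fconnect_mem uv uW.
rewrite eq_sym in nuv.
by have := fconnect_depth vW vu nuv; lia.
Qed.

Lemma par_neq v : v \in W -> v != rt -> par v != v.
Proof.
move=> vW vrt; apply/eqP => pv; have := depth_par vW vrt; rewrite pv; lia.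
Qed.

Lemma fconnect_step u v : fconnect par u v -> u != v -> fconnect par (par u) v.
Proof.
move=> uv; rewrite eq_sym => nuv.
rewrite -(iter_findex uv) (fconnect_findex uv nuv) iterSr.
exact: fconnect_iter.
Qed.

Lemma fconnect_last u v : fconnect par u v -> u != v ->
  exists c, [/\ fconnect par u c, par c = v & c != v].
Proof.
move=> uv; rewrite eq_sym => nuv; exists (iter (findex par (par u) v) par u); split.
- exact: fconnect_iter.
- by rewrite -iterS -(fconnect_findex uv nuv) iter_findex.
- apply/eqP => ev.
  have := fconnect_findex uv nuv; set k := findex par (par u) v in ev *.
  move=> e.
  have lt : (k < order par u)%N.
    by have := findex_max uv; rewrite e; lia.
  by have := findex_iter lt; rewrite ev e; lia.
Qed.

Lemma fconnect_total u a b : fconnect par u a -> fconnect par u b ->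
  fconnect par a b \/ fconnect par b a.
Proof.
move=> /iter_findex <- /iter_findex <-.
move: (findex par u a) (findex par u b) => i j.
have [ij|/ltnW ij] := leqP i j; [left|right].
  by rewrite -(subnK ij) iterD fconnect_iter.
by rewrite -(subnK ij) iterD fconnect_iter.
Qed.

(** Triangle inequality along the path from [u] up to [v]. An edge is named by its lower end, hence
    the condition [z != v]. *)
Lemma chain_dist (R : realFieldType) (d : V -> V -> R) u v :
  pmetric d -> u \in W -> fconnect par u v ->
  d u v <= \sum_(z in W | [&& fconnect par u z, fconnect par z v & z != v])
             d z (par z).
Proof.
move=> dm; have [n] := ubnP (depth u); elim: n u => // n IH u ltn uW uv.
have [<-|nuv] := eqVneq u v.
  by case: (dm) => -> _ _; apply: sumr_ge0 => *; exact: pmetric_ge0.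
have urt : u != rt.
  by apply: contra nuv => /eqP eu; move: uv; rewrite eu => /fconnect_rt ->.
have pW : par u \in W by case: T => _ _ h _; exact: h.
have puv := fconnect_step uv nuv.
rewrite (bigD1 u) /=; last by rewrite uW uv nuv connect0.
have [_ _ dt] := dm; apply: le_trans (dt u (par u) v) _; rewrite lerD2l.
apply: le_trans (IH (par u) _ pW puv) _.
  by move: ltn; rewrite depth_par.
rewrite [leRHS](bigID (fun z => fconnect par (par u) z)) /=.
rewrite [X in _ <= X + _](_ : _ = \sum_(z in W | [&& fconnect par (par u) z,
   fconnect par z v & z != v]) d z (par z)).
  by rewrite lerDl; apply: sumr_ge0 => *; exact: pmetric_ge0.
apply: eq_bigl => z; case zW: (z \in W) => //=.
case puz: (fconnect par (par u) z); rewrite ?andbF //= andbT.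
rewrite (connect_trans (fconnect1 _ _) puz) /=.
suff -> : z != u by rewrite andbT.
apply/eqP => zu; have := fconnect_anti uW (fconnect1 _ _).
by rewrite -{2}zu puz => /(_ isT) e; have := par_neq uW urt; rewrite -e eqxx.
Qed.

End RootedTree.

(** * Undirected edge lists and breadth-first trees *)

Definition edge_rel (V : finType) (L : seq (V * V)) : rel V :=
  [rel u v | ((u, v) \in L) || ((v, u) \in L)].

Lemma edge_rel_sym (V : finType) (L : seq (V * V)) : symmetric (edge_rel L).
Proof. by move=> u v; rewrite /edge_rel /= orbC. Qed.

Lemma edge_connect_sym (V : finType) (L : seq (V * V)) u v :
  connect (edge_rel L) u v = connect (edge_rel L) v u.
Proof. exact: sym_connect_sym (@edge_rel_sym _ _) u v. Qed.

Lemma ler_sum_subseq (R : realFieldType) (I : eqType) (r s : seq I)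
    (g : I -> R) : uniq r -> {subset r <= s} -> (forall i, 0 <= g i) ->
  \sum_(i <- r) g i <= \sum_(i <- s) g i.
Proof.
move=> + + g0; elim: r s => [|x r IH] s /=.
  by move=> _ _; rewrite big_nil; apply: sumr_ge0.
case/andP=> xr ur rs; have xs : x \in s by apply: rs; rewrite mem_head.
rewrite big_cons (perm_big _ (perm_to_rem xs)) /= big_cons lerD2l.
apply: IH => // y yr; have ys : y \in s by apply: rs; rewrite inE yr orbT.
move: ys; rewrite (perm_mem (perm_to_rem xs)) inE => /orP[/eqP yx|//].
by rewrite -yx yr in xr.
Qed.

(** The parent of a point is a neighbour closer to the root in number of edges. The function [g]
    comes after [par] because the same tree is used with distances and with indicators of long
    edges. *)
Lemma rooted_spanning_tree (R : realFieldType) (V : finType) (L : seq (V * V))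
    (W : {set V}) (rt : V) :
  rt \in W -> (forall p, p \in L -> (p.1 \in W) && (p.2 \in W)) ->
  (forall v, v \in W -> connect (edge_rel L) v rt) ->
  exists par, rooted_tree W rt par /\
    forall g : V -> V -> R, (forall x y, g x y = g y x) ->
      (forall x y, 0 <= g x y) ->
      \sum_(v in W | v != rt) g v (par v) <= \sum_(p <- L) g p.1 p.2.
Proof.
move=> rtW LW con; set e := edge_rel L.
(* [D n] is the ball of radius [n] about [rt] in number of edges. *)
pose D := fix D n := if n is m.+1 then
  D m :|: [set v | [exists u, e v u && (u \in D m)]] else [set rt].
have exD v : exists n, (v \in W) ==> (v \in D n).
  case vW: (v \in W); last by exists 0%N.
  have /connectP[p] := con v vW; elim: p v {vW} => [|u p IH] v /=.
    by move=> _ /= <-; exists 0%N; rewrite inE.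
  case/andP=> evu pp lst; have [n un] := IH u pp lst; exists n.+1.
  by rewrite /= !inE; apply/orP; right; apply/existsP; exists u; apply/andP.
pose dist v := ex_minn (exD v).
have step v : v \in W -> v != rt -> exists u, e v u && (dist u < dist v)%N.
  move=> vW vrt; rewrite {2}/dist; case: ex_minnP => -[|n].
    by rewrite vW /= inE (negPf vrt).
  rewrite vW /= !inE => /orP[vD /(_ n)|]; first by rewrite vD; lia.
  move=> /existsP[u /andP[evu uD]] _; exists u; rewrite evu /=.
  by rewrite /dist; case: ex_minnP => m _ /(_ n); rewrite uD implybT; lia.
pose par v := if v == rt then rt else odflt v [pick u | e v u && (dist u < dist v)%N].
have parE v : v \in W -> v != rt -> e v (par v) && (dist (par v) < dist v)%N.
  move=> vW vrt; rewrite /par (negPf vrt); case: pickP => [u //|none].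
  by have [u] := step v vW vrt; rewrite none.
have parW v : v \in W -> par v \in W.
  have [-> _|vrt vW] := eqVneq v rt; first by rewrite /par eqxx.
  by have /andP[/orP[/LW/andP[]|/LW/andP[]]] := parE v vW vrt.
exists par; split.
  split=> //; first by rewrite /par eqxx.
  move=> v; have [n] := ubnP (dist v); elim: n v => // n IH v ltn vW.
  have [->|vrt] := eqVneq v rt; first exact: connect0.
  have /andP[_ lt] := parE v vW vrt.
  apply: connect_trans (fconnect1 _ _) (IH _ _ (parW _ vW)); lia.
move=> g gs g0.
(* The tree edge of [v] in an orientation in which [L] lists it. Two different points with the same
   edge would each be closer to the root than the other, so no edge is used twice. *)
pose f v := if (v, par v) \in L then (v, par v) else (par v, v).
rewrite (eq_bigr (fun v => g (f v).1 (f v).2)); last first.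
  by move=> v _; rewrite /f; case: ifP => //= _.
rewrite -big_enum_cond /= -(big_filter _ (fun v => v != rt)).
rewrite -(big_map f predT (fun p => g p.1 p.2)).
have ue := enum_uniq W; have me := mem_enum W; move: (enum W) ue me => E ue me.
apply: ler_sum_subseq => [|p|p]; last exact: g0.
  rewrite map_inj_in_uniq; first exact: filter_uniq.
  move=> u v; rewrite !mem_filter !me => /andP[urt uW] /andP[vrt vW].
  have /andP[_ du] := parE u uW urt; have /andP[_ dv] := parE v vW vrt.
  rewrite /f; case: ifP => _; case: ifP => _ [] // e1 e2.
    by move: du dv; rewrite e2 -e1; lia.
  by move: du dv; rewrite e1 -e2; lia.
case/mapP=> v; rewrite mem_filter me => /andP[vrt vW] ->.
have /andP[] := parE v vW vrt; rewrite /e /edge_rel /= /f.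
by case: ifP => //= _.
Qed.

(** A simple path from [y] to [s] enters [s] through some [c], and its part from [y] to [c] avoids
    [s]. Together with an edge between [s] and [y], this part replaces the edge between [s] and
    [c]. *)
Lemma edge_exchange (V : finType) (L : seq (V * V)) (s y a b : V) :
  (forall z, edge_rel L s z -> z = a \/ z = b) ->
  connect (edge_rel L) y s -> y != s ->
  exists c, [/\ c = a \/ c = b, edge_rel L s c &
    forall L', (forall u v, edge_rel L u v ->
       ~~ (((u == s) && (v == c)) || ((u == c) && (v == s))) ->
       edge_rel L' u v) -> edge_rel L' s y ->
    forall u v, connect (edge_rel L) u v -> connect (edge_rel L') u v].
Proof.
move=> nbr /connectP[p0 pp0 lst0] ys.
case: (shortenP pp0) lst0 => p pp up _ lst {p0 pp0}.
case/lastP: p pp up lst => [|p z] /=; first by move=> _ _ sy; rewrite sy eqxx in ys.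
rewrite last_rcons rcons_path => /andP[pp ez] up sz; subst z.
set c := last y p in ez; exists c; split.
- by apply: nbr; rewrite edge_rel_sym.
- by rewrite edge_rel_sym.
move=> K LK sK.
have snotin : s \notin y :: p.
  by move: up; rewrite -[_ && _]/(uniq (rcons (y :: p) s)) rcons_uniq => /andP[].
have pathK x q : path (edge_rel L) x q -> s \notin x :: q ->
    path (edge_rel K) x q.
  elim: q x => //= z q IH x /andP[exz pq].
  rewrite inE negb_or => /andP[sx sp]; rewrite IH // andbT.
  apply: LK => //; rewrite !negb_or.
  by move: sp; rewrite inE negb_or [z == s]eq_sym => /andP[/negPf -> _];
    rewrite eq_sym (negPf sx) !andbF.
have cK : connect (edge_rel K) s c.
  apply: connect_trans (connect1 sK) _.
  by apply/connectP; exists p => //; exact: pathK.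
move=> u v; apply: connect_sub => {u v} u v euv.
case rem: (((u == s) && (v == c)) || ((u == c) && (v == s))).
  case/orP: rem => /andP[/eqP -> /eqP ->] //.
  by rewrite edge_connect_sym.
by apply: connect1; apply: LK => //; rewrite rem.
Qed.

(** * Leaves and branching points *)

Section Children.
Variables (V : finType) (W : {set V}) (rt : V) (par : V -> V).
Hypothesis T : rooted_tree W rt par.

Definition children v := [set u in W | (u != rt) && (par u == v)].

Definition leaves := [set v in W | (v != rt) && (children v == set0)].

Definition branchings := [set v in W | (1 < #|children v|)%N].

Lemma leaf_minimal u v : u \in W -> fconnect par u v -> children v = set0 -> u = v.
Proof.
move=> uW uv cv; apply/eqP/negPn/negP => nuv.
have [c [uc pc cvn]] := fconnect_last uv nuv.
suff : c \in children v by rewrite cv inE.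
rewrite inE pc eqxx andbT (fconnect_mem T uc uW) /=.
apply: contra cvn => /eqP cr; case: T => _ prt _ _.
by rewrite -pc cr prt.
Qed.

(** At each point, the indicator of branching plus 1 is at most the number of children plus the
    indicator of having none. There are [#|W| - 1] children in all, and the missing 1 pays for a
    childless root, which is not in [leaves]. *)
Lemma card_branchings : (#|branchings| <= #|leaves|)%N.
Proof.
have [rtW prt Wpar con] := T.
have cW : (\sum_(v in W) #|children v| = #|W :\ rt|)%N.
  rewrite -[RHS]sum1_card [RHS](partition_big par (mem W)) /=; last first.
    by move=> v; rewrite in_setD1 => /andP[_ vW]; exact: Wpar.
  apply: eq_bigr => v vW; rewrite -sum1_card; apply: eq_bigl => u.
  by rewrite !inE andbA [(u \in W) && _]andbC.
have le : (\sum_(v in W) ((v \in branchings) + 1) <=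
           \sum_(v in W) (#|children v| + (children v == set0)))%N.
  apply: leq_sum => v vW; rewrite inE vW /=.
  by rewrite -cards_eq0; case: #|_| => [|[|n]].
have cnt (P : pred V) : (\sum_(v in W) P v = #|[set v in W | P v]|)%N.
  by rewrite -sum1_card big_mkcond [RHS]big_mkcond; apply: eq_bigr => v _;
    rewrite inE; case: (v \in W) => //=; case: (P v).
move: le; rewrite !big_split /= cW sum1_card !cnt.
have -> : #|[set v in W | v \in branchings]| = #|branchings|.
  by apply: eq_card => v; rewrite !inE andbA andbb.
rewrite (cardsD1 rt W) rtW.
have : (#|[set v in W | children v == set0]| <=
    (rt \in [set v in W | children v == set0]) + #|leaves|)%N.
  rewrite (cardsD1 rt) leq_add2l; apply: subset_leq_card.
  by apply/subsetP => v; rewrite !inE => /and3P[-> -> ->].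
case: (rt \in _) => /=; lia.
Qed.

End Children.

(** * Trimming short branches *)

Section Trim.
Variables (R : realFieldType) (V : finType) (dl : V -> V -> R) (th : R).
Variables (W : {set V}) (rt : V) (par : V -> V).
Hypotheses (dm : pmetric dl) (th0 : 0 < th) (T : rooted_tree W rt par).

Lemma trim : exists W' : {set V}, [/\ W' \subset W, rooted_tree W' rt par,
  forall w, w \in W -> exists2 w', w' \in W' & dl w w' < 2 * th &
  forall v, v \in leaves W' rt par ->
    exists u, [/\ u \in W, fconnect par u v & 2 * th <= dl (par v) u]].
Proof.
have [rtW prt Wpar con] := T.
(* [A] holds the points whose branch, measured from their parent, reaches distance [2 * th]; [W']
   consists of the root and of all ancestors of [A], including [A] itself. *)
pose A := [set v in W | (v != rt) &&
  [exists u in W, fconnect par u v && (2 * th <= dl (par v) u)]].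
pose W' := rt |: [set v in W | [exists a in A, fconnect par a v]].
have W'W : W' \subset W.
  by apply/subsetP => v; rewrite !inE => /orP[/eqP ->//|/andP[]].
have AW' a v : a \in A -> fconnect par a v -> v \in W'.
  move=> aA av; rewrite !inE; apply/orP; right.
  have aW : a \in W by move: aA; rewrite inE => /andP[].
  rewrite (fconnect_mem T av aW); apply/exists_inP.
  by exists a.
have T' : rooted_tree W' rt par.
  split=> // [|v|v vW']; first by rewrite !inE eqxx.
    rewrite {1}/W' !inE => /orP[/eqP ->|/andP[vW /exists_inP[a aA av]]].
      by rewrite prt eqxx.
    have := AW' a (par v) aA (connect_trans av (fconnect1 _ _)).
    by rewrite !inE.
  by apply: con; apply: (subsetP W'W).
have first_out w k : w \notin W' -> iter k par w = rt ->
    exists c, [/\ fconnect par w c, c \notin W' & par c \in W'].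
  elim: k w => [|k IH] w wn; first by move=> /= wr; rewrite !inE wr eqxx in wn.
  rewrite iterSr => /IH {}IH; have [pW|pW] := boolP (par w \in W').
    by exists w; rewrite connect0.
  have [c [wc cn pc]] := IH pW; exists c; split=> //.
  exact: connect_trans (fconnect1 _ _) wc.
exists W'; split=> //.
- move=> w wW; have [wW'|wn] := boolP (w \in W').
    by exists w => //; case: dm => -> _ _; rewrite mulr_gt0.
  (* If [w] were at distance [2 * th] or more from [par c], then [c] would belong to [A] and hence
     to [W']. *)
  have [c [wc cn pc]] := first_out w _ wn (iter_findex (con w wW)).
  exists (par c) => //; rewrite ltNge; apply/negP => le.
  have cn' := cn; move: cn => /negP; apply; apply: (AW' c c) => //.
  have cW := fconnect_mem T wc wW; have [_ ds _] := dm.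
  rewrite inE cW /=; apply/andP; split.
    by apply: contra cn' => /eqP ->; rewrite !inE eqxx.
  by apply/exists_inP; exists w => //; rewrite wc ds.
- move=> v; rewrite inE => /and3P[vW' vr /eqP cv].
  move: (vW'); rewrite {1}/W' !inE (negPf vr) /= => /andP[vW /exists_inP[a aA av]].
  (* The member of [A] below the leaf [v] lies in [W'], so it is [v] itself. *)
  have := leaf_minimal T' (AW' a a aA (connect0 _ _)) av cv => av'.
  rewrite -av'; move: aA; rewrite inE => /and3P[_ _ /exists_inP[u uW /andP[ua le]]].
  by exists u.
Qed.

Definition long_edges (rho : R) := [set v in W | (v != rt) && (rho <= dl v (par v))].

(** A leaf whose parent edge is shorter than [th] has, in the part cut off below it, a point at
    distance at least [th]. The path from that point up to the leaf is lost, and the parts cut off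
    below different leaves are disjoint. *)
Lemma trim_weight (W' : {set V}) : W' \subset W -> rooted_tree W' rt par ->
  (forall v, v \in leaves W' rt par ->
    exists u, [/\ u \in W, fconnect par u v & 2 * th <= dl (par v) u]) ->
  \sum_(v in W' | v != rt) dl v (par v)
    + th * #|leaves W' rt par :\: long_edges th|%:R
  <= \sum_(v in W | v != rt) dl v (par v).
Proof.
move=> W'W T' lvP; set Lt := _ :\: _.
have dl0 x y : 0 <= dl x y by exact: pmetric_ge0.
rewrite [leRHS](bigID (mem W')) /=.
rewrite [X in _ <= X + _](_ : _ = \sum_(v in W' | v != rt) dl v (par v)); last first.
  apply: eq_bigl => v; rewrite andbC andbA.
  by case vW': (v \in W') => //=; rewrite (subsetP W'W).
rewrite lerD2l.
pose below l u := (u \notin W') && fconnect par u l.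
have W'c u v : u \in W' -> fconnect par u v -> v \in W'.
  by move=> uW' uv; apply: (fconnect_mem T' uv uW').
pose N l := [set u in W | (u != rt) && below l u].
have step l : l \in Lt -> th <= \sum_(u in N l) dl u (par u).
  rewrite inE => /andP[lLg lLv].
  have [u [uW ul le]] := lvP l lLv.
  move: (lLv); rewrite inE => /and3P[lW' lr /eqP cl].
  have lW := subsetP W'W _ lW'.
  have short : dl l (par l) < th.
    by rewrite ltNge; apply: contra lLg; rewrite inE lW lr.
  have thlu : th <= dl u l.
    have [_ ds dt] := dm; have := dt (par l) l u.
    by rewrite (ds (par l) l) (ds l u); move: le short; lra.
  apply: le_trans thlu _; apply: le_trans (chain_dist T dm uW ul) _.
  apply: ler_sum_sub => // z /and4P[zW uz zl nzl].
  rewrite inE zW /= /below zl andbT.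
  have zn : z \notin W'.
    by apply: contra nzl => zW'; rewrite (leaf_minimal T' zW' zl cl).
  rewrite zn andbT; apply: contra zn => /eqP ->.
  by case: T'.
have disj l l' u : l \in Lt -> l' \in Lt -> below l u -> below l' u -> l = l'.
  rewrite !inE => /and4P[_ lW' _ /eqP cl] /and4P[_ lW'' _ /eqP cl'].
  case/andP=> _ ul /andP[_ ul'].
  have [ll|ll] := fconnect_total ul ul'; first exact: (leaf_minimal T' lW' ll cl').
  by symmetry; exact: (leaf_minimal T' lW'' ll cl).
rewrite mulr_natr -sumr_const.
apply: le_trans (ler_sum _ step) _.
rewrite [leRHS](eq_bigl (mem [set u in W | (u != rt) && (u \notin W')])); last first.
  by move=> u; rewrite !inE andbA.
apply: ler_sum_disjoint => // [l _|l l' u lLt l'Lt].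
  by apply/subsetP => u; rewrite !inE => /and4P[-> -> -> _].
by rewrite !inE => /and3P[_ _ lu] /and3P[_ _ l'u]; exact: disj lu l'u.
Qed.
End Trim.

(** * Exchanging edges of a tree at one scale *)

(* The tree path from [b s] below [s] to [a s] above [s] has length at least
   12 th. It is replaced by the edges (b s, s) and (s, a s), each of length at
   least 6 th, and one of these is then exchanged for the chord (s, y s). *)
Section Contract.
Variables (R : realFieldType) (V : finType) (dl : V -> V -> R) (th : R).
Variables (W : {set V}) (rt : V) (par : V -> V) (I J : {set V}) (y : V -> V).
Hypotheses (dm : pmetric dl) (th0 : 0 < th) (T : rooted_tree W rt par).
Hypotheses (IW : I \subset W) (yW : forall s, s \in I -> y s \in W).
Hypotheses (rtJ : rt \in J) (brJ : branchings W rt par \subset J)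
  (lvJ : leaves W rt par \subset J)
  (lgJ : forall v, v \in long_edges dl W rt par th -> v \in J /\ par v \in J).
(** [J] gathers the obstacles. The clearance [6 * th] makes each half of the path at least that
    long, so that a chord of length at most [5 * th] gains [th]. In [sepI], 13 is 6 + 7: chains have
    radius 6 and their end points lie within 7. By [farI] the partners [y s] avoid all chains. *)
Hypothesis freeI : forall s j, s \in I -> j \in J -> 6 * th <= dl s j.
Hypothesis sepI : forall s s', s \in I -> s' \in I -> s != s' ->
  13 * th <= dl s s'.
Hypothesis farI : forall s s', s \in I -> s' \in I -> 6 * th <= dl s' (y s).

Let dl0 u v : 0 <= dl u v. Proof. exact: pmetric_ge0. Qed.
Let dlvv v : dl v v = 0. Proof. by case: dm. Qed.
Let dlC u v : dl u v = dl v u. Proof. by case: dm. Qed.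
Let dlD u v w : dl u w <= dl u v + dl v w. Proof. by case: dm. Qed.
Let neqr s v : 6 * th <= dl s v -> v != s.
Proof. by rewrite leNgt; apply: contraNneq => ->; rewrite dlvv mulr_gt0. Qed.

Let seven : 7 = 6 + 1 :> R. Proof. by rewrite natr1. Qed.

Let IrtF s : s \in I -> s != rt.
Proof. by move=> sI; rewrite eq_sym neqr // freeI. Qed.

Let short v : v \in W -> v != rt -> v \notin J \/ par v \notin J ->
  dl v (par v) < th.
Proof.
move=> vW vr h; rewrite ltNge; apply/negP => le.
have [|vJ pJ] := lgJ (v := v); first by rewrite inE vW vr.
by case: h; rewrite ?vJ ?pJ.
Qed.

Let nearJ s z : s \in I -> dl s z < 6 * th -> z \notin J.
Proof. by move=> sI; apply: contraTN => zJ; rewrite -leNgt freeI. Qed.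

(** [a] is the lowest ancestor of [s] at distance at least [6 * th]; the root is a candidate. The
    point just below [a] is closer to [s], hence outside [J], so the last edge is shorter than
    [th]. *)
Lemma exists_upper s : s \in I -> exists a, [/\ fconnect par s a,
  6 * th <= dl s a, dl s a < 7 * th &
  forall z, fconnect par s z -> fconnect par z a -> z != a -> dl s z < 6 * th].
Proof.
move=> sI; have sW := subsetP IW _ sI; have [rtW prt _ con] := T.
have rtC : fconnect par s rt && (6 * th <= dl s rt) by rewrite con // freeI.
case: (@arg_maxnP _ rt (fun a => fconnect par s a && (6 * th <= dl s a))
  (fun a => findex par a rt) rtC) => a /andP[sa le] amax.
have bel z : fconnect par s z -> fconnect par z a -> z != a -> dl s z < 6 * th.
  move=> sz za nza; rewrite ltNge; apply/negP => lez.
  have := amax z; rewrite sz lez => /(_ isT).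
  by rewrite /= leqNgt (fconnect_depth T (fconnect_mem T sz sW) za nza).
exists a; split=> //.
have nsa : s != a by rewrite eq_sym neqr.
have [c [sc pc nca]] := fconnect_last sa nsa.
have dsc := bel c sc; rewrite -{1}pc fconnect1 in dsc.
have {}dsc := dsc isT nca.
have cr : c != rt by apply: contra nca => /eqP cr; rewrite -pc cr prt.
have := short (fconnect_mem T sc sW) cr (or_introl (nearJ sI dsc)).
rewrite pc => dca; apply: le_lt_trans (dlD s c a) _.
by rewrite seven mulrDl mul1r ltrD.
Qed.

Lemma exists_lower s : s \in I -> exists b, [/\ b \in W, fconnect par b s,
  6 * th <= dl s b, dl s b < 7 * th &
  forall z, fconnect par b z -> fconnect par z s -> z != b -> dl s z < 6 * th].
Proof.
move=> sI; have sW := subsetP IW _ sI; have [rtW prt _ con] := T.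
have notrt z : fconnect par z s -> z != rt.
  move=> zs; apply/eqP => zr; move: zs; rewrite zr => /(fconnect_rt T) e.
  by move: (IrtF sI); rewrite e eqxx.
have sC : (s \in W) && fconnect par s s by rewrite sW connect0.
(* A deepest descendant of [s] is a leaf, hence in [J] and at distance at least [6 * th]. This
   provides a candidate for [b], which is then chosen as high as possible. *)
case: (@arg_maxnP _ s (fun a => (a \in W) && fconnect par a s)
  (fun a => findex par a rt) sC) => l /andP[lW ls] lmax.
have lJ : l \in J.
  apply: (subsetP lvJ); rewrite inE lW notrt //=.
  apply/eqP/setP => c; rewrite !inE; apply/negP => /and3P[cW cr /eqP pc].
  have := lmax c; rewrite cW; have -> : fconnect par c s.
    by apply: connect_trans (fconnect1 _ _) _; rewrite pc.
  by move=> /(_ isT); rewrite /= (depth_par T cW cr) pc ltnn.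
have lC : [&& l \in W, fconnect par l s & 6 * th <= dl s l].
  by rewrite lW ls freeI.
case: (@arg_minnP _ l (fun b => [&& b \in W, fconnect par b s & 6 * th <= dl s b])
  (fun a => findex par a rt) lC) => b /and3P[bW bs le] bmin.
have bel z : fconnect par b z -> fconnect par z s -> z != b -> dl s z < 6 * th.
  move=> bz zs nzb; rewrite ltNge; apply/negP => lez.
  have := bmin z; rewrite (fconnect_mem T bz bW) zs lez => /(_ isT).
  by rewrite eq_sym in nzb; rewrite /= leqNgt (fconnect_depth T bW bz nzb).
exists b; split=> //.
have nbs := neqr le.
have ds : dl s (par b) < 6 * th.
  by apply: bel; rewrite ?fconnect1 ?(fconnect_step bs) // (par_neq T) // notrt.
have := short bW (notrt b bs) (or_intror (nearJ sI ds)).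
rewrite dlC => dpb; apply: le_lt_trans (dlD s (par b) b) _.
by rewrite seven mulrDl mul1r ltrD.
Qed.

Section Chains.
Variables a b : V -> V.
Hypothesis aP : forall s, s \in I -> [/\ fconnect par s (a s),
  6 * th <= dl s (a s), dl s (a s) < 7 * th &
  forall z, fconnect par s z -> fconnect par z (a s) -> z != a s ->
    dl s z < 6 * th].
Hypothesis bP : forall s, s \in I -> [/\ b s \in W, fconnect par (b s) s,
  6 * th <= dl s (b s), dl s (b s) < 7 * th &
  forall z, fconnect par (b s) z -> fconnect par z s -> z != b s ->
    dl s z < 6 * th].

(** The inner points of the path from [b s] up to [a s], all to be contracted to [s]. *)
Definition chain s := [set z | [&& fconnect par (b s) z, fconnect par z (a s),
  z != a s & z != b s]].

Let sW s : s \in I -> s \in W. Proof. by move/(subsetP IW). Qed.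
Let bW s : s \in I -> b s \in W. Proof. by case/bP. Qed.
Let aW s : s \in I -> a s \in W.
Proof. by move=> sI; case: (aP sI) => sa _ _ _; exact: (fconnect_mem T sa (sW sI)). Qed.

Lemma chain_W s z : s \in I -> z \in chain s -> z \in W.
Proof. by move=> sI; rewrite inE => /and4P[bz _ _ _]; exact: (fconnect_mem T bz (bW sI)). Qed.

Lemma chain_near s z : s \in I -> z \in chain s -> dl s z < 6 * th.
Proof.
move=> sI; rewrite inE => /and4P[bz za nza nzb].
have [_ bs _ _ bel] := bP sI; have [sa _ _ abo] := aP sI.
by have [zs|sz] := fconnect_total bz bs; [exact: bel|exact: abo].
Qed.

Lemma mem_chain s : s \in I -> s \in chain s.
Proof.
move=> sI; have [sa la _ _] := aP sI; have [_ bs lb _ _] := bP sI.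
by rewrite inE bs sa /= ![s == _]eq_sym !neqr.
Qed.

Lemma chain_disjoint s s' z : s \in I -> s' \in I -> z \in chain s ->
  z \in chain s' -> s = s'.
Proof.
move=> sI s'I /(chain_near sI) d1 /(chain_near s'I) d2.
apply/eqP/negPn/negP => /(sepI sI s'I); apply/negP; rewrite -ltNge.
apply: le_lt_trans (dlD s z s') _; rewrite [dl z _]dlC.
apply: lt_trans (ltrD d1 d2) _; rewrite -mulrDl -natrD.
by rewrite ltr_pM2r ?ltr_nat.
Qed.

Lemma chain_notJ s z : s \in I -> z \in chain s -> z \notin J.
Proof. by move=> sI /(chain_near sI); exact: nearJ. Qed.

Let thirteen : 13 * th = 7 * th + 6 * th.
Proof. by rewrite -mulrDl -natrD. Qed.

Lemma near_notchain s s' v : s \in I -> s' \in I -> s != s' ->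
  dl s v < 7 * th -> v \notin chain s'.
Proof.
move=> sI s'I ns d; apply/negP => /(chain_near s'I) d'.
have := sepI sI s'I ns; apply/negP; rewrite -ltNge thirteen.
by apply: le_lt_trans (dlD s v s') _; rewrite [dl v _]dlC ltrD.
Qed.

Lemma upper_notchain s s' : s \in I -> s' \in I -> a s \notin chain s'.
Proof.
move=> sI s'I; have [<-|ns] := eqVneq s s'; first by rewrite inE eqxx !andbF.
by apply: (near_notchain sI s'I ns); case: (aP sI).
Qed.

Lemma lower_notchain s s' : s \in I -> s' \in I -> b s \notin chain s'.
Proof.
move=> sI s'I; have [<-|ns] := eqVneq s s'; first by rewrite inE eqxx !andbF.
by apply: (near_notchain sI s'I ns); case: (bP sI).
Qed.

Lemma chain_par s v : s \in I -> v \in chain s ->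
  par v \in chain s \/ par v = a s.
Proof.
move=> sI vc; move: (vc); rewrite inE => /and4P[bv va nva nvb].
have [pa|npa] := eqVneq (par v) (a s); [by right|left].
rewrite inE npa (connect_trans bv (fconnect1 _ _)) (fconnect_step va nva) /=.
apply: contra nvb => /eqP pb; apply/eqP; apply: (fconnect_anti T) => //.
  exact: chain_W vc.
by rewrite -pb fconnect1.
Qed.

Let b_neq_rt s : s \in I -> b s != rt.
Proof.
move=> sI; have [_ bs _ _ _] := bP sI; apply/eqP => br.
by move: bs (IrtF sI); rewrite br => /(fconnect_rt T) ->; rewrite eqxx.
Qed.

Lemma lower_par s : s \in I -> par (b s) \in chain s.
Proof.
move=> sI; have [bW' bs lb _ _] := bP sI; have [sa la _ _] := aP sI.
have pbs := fconnect_step bs (neqr lb).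
rewrite inE fconnect1 (connect_trans pbs sa) (par_neq T bW') ?b_neq_rt // andbT /=.
apply: contraTneq la => pa; rewrite -ltNge.
have -> : a s = s.
  by apply/esym; apply: (fconnect_anti T (sW sI) sa); rewrite -pa.
by rewrite dlvv mulr_gt0.
Qed.

(** The lower ends of the edges on the contracted paths; [b s] is among them although it survives
    the contraction. *)
Definition merged := \bigcup_(s in I) (b s |: chain s).

Lemma mergedP v :
  reflect (exists2 s, s \in I & v = b s \/ v \in chain s) (v \in merged).
Proof.
apply: (iffP bigcupP) => -[s sI h]; exists s => //.
  by move: h; rewrite in_setU1 => /orP[/eqP|]; [left|right].
by rewrite in_setU1; case: h => [->|->]; rewrite ?eqxx ?orbT.
Qed.

(** A chain point is outside [J], hence no branching point, and its only child is on the path: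
    nothing else hangs on a chain. *)
Lemma unmerged_par v s : v \in W -> v != rt -> v \notin merged -> s \in I ->
  par v \notin chain s.
Proof.
move=> vW vr vM sI; apply/negP => pc.
have pJ := chain_notJ sI pc; have pW := chain_W sI pc.
have [_ prt _ _] := T.
have card1 : (#|children W rt par (par v)| <= 1)%N.
  rewrite leqNgt; apply: contra pJ => lt; apply: (subsetP brJ).
  by rewrite inE pW.
move: (pc); rewrite inE => /and4P[bp pa npa npb].
rewrite eq_sym in npb; have [c [bc pcv ncp]] := fconnect_last bp npb.
have cW := fconnect_mem T bc (bW sI).
have cr : c != rt by apply: contra ncp => /eqP cr; rewrite -pcv cr prt.
have cv : c = v.
  by apply: (card_le1_eqP card1); rewrite inE ?cW ?vW ?cr ?vr ?pcv eqxx.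
rewrite cv in bc; move: vM => /negP; apply; apply/mergedP; exists s => //.
have [->|nvb] := eqVneq v (b s); [by left|right].
rewrite inE bc nvb (connect_trans (fconnect1 _ _) pa) /= andbT.
apply: contra npa => /eqP va; rewrite va in pa *.
have := fconnect_anti T (aW sI) (fconnect1 _ _) pa => ea.
by rewrite -ea.
Qed.

Definition proj v := if [pick s in I | v \in chain s] is Some s then s else v.

Lemma proj_chain s v : s \in I -> v \in chain s -> proj v = s.
Proof.
move=> sI vc; rewrite /proj; case: pickP => [s' /andP[s'I vc']|/(_ s)].
  exact: chain_disjoint s'I sI vc' vc.
by rewrite sI vc.
Qed.

Lemma proj_id v : (forall s, s \in I -> v \notin chain s) -> proj v = v.
Proof.
move=> h; rewrite /proj; case: pickP => // s /andP[sI vc].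
by have := h s sI; rewrite vc.
Qed.

(** A list, so that the weight can be followed through permutations while edges are exchanged one at
    a time. *)
Definition contracted : seq (V * V) :=
  [seq (v, par v) | v <- enum ((W :\ rt) :\: merged)] ++
  [seq (b s, s) | s <- enum I] ++ [seq (s, a s) | s <- enum I].

Lemma contracted_case u v : (u, v) \in contracted ->
  [\/ [/\ u \in W, u != rt, u \notin merged & v = par u],
      exists2 s, s \in I & u = b s /\ v = s |
      exists2 s, s \in I & u = s /\ v = a s].
Proof.
rewrite !mem_cat => /or3P[]/mapP[s]; rewrite mem_enum.
- by rewrite !inE => /and3P[? ? ?] [-> ->]; constructor 1.
- by move=> sI [-> ->]; constructor 2; exists s.
- by move=> sI [-> ->]; constructor 3; exists s.
Qed.

Lemma contracted_link s : s \in I ->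
  (b s, s) \in contracted /\ (s, a s) \in contracted.
Proof.
by move=> sI; split; rewrite !mem_cat; apply/or3P; [constructor 2|constructor 3];
  apply/mapP; exists s; rewrite ?mem_enum.
Qed.

Lemma notin_merged_proj v : v \notin merged -> proj v = v.
Proof.
move=> vM; apply: proj_id => s sI; apply: contra vM => vc.
by apply/mergedP; exists s => //; right.
Qed.

Lemma contracted_connect v : v \in W -> connect (edge_rel contracted) (proj v) rt.
Proof.
have [rtW prt Wpar con] := T.
move=> vW; have := iter_findex (con v vW); move: (findex _ _ _) => k.
elim: k v vW => [|k IH] v vW.
  move=> /= ->; suff -> : proj rt = rt by exact: connect0.
  by apply: proj_id => s sI; apply: contraL rtJ; exact: chain_notJ.
have [-> _|vr] := eqVneq v rt.
  suff -> : proj rt = rt by exact: connect0.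
  by apply: proj_id => s sI; apply: contraL rtJ; exact: chain_notJ.
rewrite iterSr => /(IH _ (Wpar _ vW)); apply: connect_trans.
have link u w : (u, w) \in contracted -> connect (edge_rel contracted) u w.
  by move=> uw; apply: connect1; rewrite /edge_rel /= uw.
have [/mergedP[s sI [->|vc]]|vM] := boolP (v \in merged).
- rewrite (proj_chain sI (lower_par sI)) proj_id; last first.
    by move=> s'; exact: lower_notchain.
  by apply: link; case: (contracted_link sI).
- rewrite (proj_chain sI vc); have [pc|->] := chain_par sI vc.
    by rewrite (proj_chain sI pc).
  rewrite proj_id => [|s' s'I]; last exact: upper_notchain.
  by apply: link; case: (contracted_link sI).
rewrite notin_merged_proj // proj_id => [|s sI]; last exact: unmerged_par.
apply: link; rewrite mem_cat; apply/orP; left; apply/mapP; exists v => //.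
by rewrite mem_enum !inE vM vr.
Qed.

(** The two new edges at [s] weigh at most the path between [b s] and [a s], and the paths of
    different [s] share no edge. *)
Lemma contracted_weight :
  \sum_(p <- contracted) dl p.1 p.2 <= \sum_(v in W | v != rt) dl v (par v).
Proof.
rewrite [leRHS](bigID (mem merged)) /= addrC !big_cat !big_map /= !big_enum /=.
apply: lerD.
  rewrite le_eqVlt; apply/orP; left; apply/eqP; apply: eq_bigl => v.
  by rewrite !inE; case: (v \in W); case: (v == rt); case: (v \in merged).
rewrite -big_split /=.
rewrite [leRHS](eq_bigl (mem merged)); last first.
  move=> v /=; rewrite andb_idl // => /mergedP[s sI [->|vc]].
    by rewrite bW // b_neq_rt.
  rewrite (chain_W sI vc) /=; apply: contraTneq rtJ => <-; exact: (chain_notJ sI vc).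
apply: le_trans (ler_sum_disjoint (N := fun s => b s |: chain s) (I := I) _ _ _).
- apply: ler_sum => s sI; have [bW' bs lb _ _] := bP sI.
  have [sa la _ _] := aP sI.
  have d1 := chain_dist T dm bW' bs; have d2 := chain_dist T dm (sW sI) sa.
  apply: le_trans (lerD d1 d2) _.
  rewrite [leRHS](bigID (fun z => fconnect par z s && (z != s))) /=.
  apply: lerD; apply: ler_sum_sub => // z /and4P[zW p1 p2 p3].
    rewrite !inE p1 p2 p3 (connect_trans p2 sa) /= andbT.
    case: eqVneq => //= _; rewrite andbT; apply/eqP => za.
    have /eqP := neqr la; apply; apply: (fconnect_anti T (aW sI)) => //.
    by rewrite -za.
  rewrite !inE p2 p3 (connect_trans bs p1) /=; apply/andP; split.
    by case: eqVneq.
  rewrite negb_and negbK orbC; case: eqVneq => //= nzs; apply/negP => zs.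
  by move/eqP: nzs; apply; exact: (fconnect_anti T zW zs p1).
- by [].
- by move=> s sI; apply/subsetP => v vs; apply/mergedP; exists s => //;
    move: vs; rewrite in_setU1 => /orP[/eqP|]; [left|right].
move=> s s' v sI s'I; rewrite !in_setU1.
case/orP=> [/eqP vb|vc]; case/orP=> [/eqP vb'|vc'].
- by apply: (chain_disjoint sI s'I (lower_par sI)); rewrite -vb vb' lower_par.
- by have := lower_notchain sI s'I; rewrite -vb vc'.
- by have := lower_notchain s'I sI; rewrite -vb' vc.
- exact: chain_disjoint vc vc'.
Qed.

Let y_notchain s s' : s \in I -> s' \in I -> y s \notin chain s'.
Proof.
move=> sI s'I; apply/negP => /(chain_near s'I); apply/negP.
by rewrite -leNgt farI.
Qed.

Lemma contracted_neighbor s z : s \in I -> edge_rel contracted s z ->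
  z = a s \/ z = b s.
Proof.
move=> sI; have sM : s \in merged.
  by apply/mergedP; exists s => //; right; exact: mem_chain.
have notb s' : s' \in I -> s <> b s'.
  move=> s'I e; have := lower_notchain s'I sI.
  by rewrite -e mem_chain.
have nota s' : s' \in I -> s <> a s'.
  move=> s'I e; have := upper_notchain s'I sI.
  by rewrite -e mem_chain.
case/orP => /contracted_case[].
- by case=> _ _; rewrite sM.
- by case=> s' s'I [/(notb _ s'I)].
- by case=> s' _ [-> ->]; left.
- case=> zW zr zM sp; have := unmerged_par zW zr zM sI.
  by rewrite -sp mem_chain.
- by case=> s' _ [-> ->]; right.
- by case=> s' s'I [_ /(nota _ s'I)].
Qed.

(** Induction on the points already treated. [Q] collects the removed edges and [S] the remaining
    ones; the last clause, that an untreated point still has both its edges, carries the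
    induction. *)
Lemma exchange_all (l : seq V) : uniq l -> {subset l <= I} ->
  exists S Q : seq (V * V), [/\ perm_eq contracted (Q ++ S),
    6 * th * (size l)%:R <= \sum_(p <- Q) dl p.1 p.2,
    forall u v, connect (edge_rel contracted) u v ->
      connect (edge_rel ([seq (s, y s) | s <- l] ++ S)) u v &
    forall s, s \in I -> s \notin l -> (b s, s) \in S /\ (s, a s) \in S].
Proof.
elim: l => [|s l IH] /=.
  move=> _ _; exists contracted, [::]; split=> //.
    by rewrite mulr0 big_nil.
  by move=> s sI _; exact: contracted_link.
case/andP=> sl ul lI; have sI : s \in I by apply: lI; rewrite mem_head.
have [|S [Q [pQ wQ cS unS]]] := IH ul.
  by move=> s' s'l; apply: lI; rewrite inE s'l orbT.
set L := _ ++ S in cS.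
have SC : {subset S <= contracted}.
  by move=> p pS; rewrite (perm_mem pQ) mem_cat pS orbT.
(* No earlier chord ends at [s]: these chords start at other points of [I], and their other ends lie
   on no chain. *)
have nbr z : edge_rel L s z -> z = a s \/ z = b s.
  rewrite /edge_rel /= !mem_cat => H; apply: contracted_neighbor => //.
  rewrite /edge_rel /=.
  case/orP: H => /orP[/mapP[s' s'l [e1 e2]]|/SC ->]; rewrite ?orbT //.
    by rewrite e1 s'l in sl.
  have s'I : s' \in I by apply: lI; rewrite inE s'l orbT.
  by have := y_notchain s'I sI; rewrite -e2 mem_chain.
have ysr : connect (edge_rel L) (y s) s.
  apply: (@connect_trans _ _ rt).
    apply: cS; rewrite -{1}[y s]proj_id; first exact/contracted_connect/yW.
    by move=> s' s'I; exact: y_notchain.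
  rewrite edge_connect_sym; apply: cS; rewrite -{1}(proj_chain sI (mem_chain sI)).
  exact/contracted_connect/sW.
have [c [cab esc xch]] := edge_exchange nbr ysr (neqr (farI sI sI)).
have [bS aS] := unS s sI sl.
(* The edge to be removed, oriented as it is listed in [contracted]. *)
pose p := if c == a s then (s, a s) else (b s, s).
have pS : p \in S by rewrite /p; case: ifP.
have pc : p = (s, c) \/ p = (c, s).
  rewrite /p; case: eqP => [->|nc]; [by left|right].
  by case: cab => // ->.
have dp : 6 * th <= dl p.1 p.2.
  rewrite /p; have [_ la _ _] := aP sI; have [_ _ lb _ _] := bP sI.
  by case: ifP; rewrite //= dlC.
have pr := perm_to_rem pS.
exists (rem p S), (p :: Q); split.
- rewrite (perm_trans pQ) // cat_cons -cat1s perm_sym perm_catCA perm_cat2l.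
  by rewrite perm_sym.
- by rewrite big_cons (mulrS 1 (size l)) mulrDr mulr1 lerD.
- move=> u v /cS; apply: xch; last by rewrite /edge_rel /= mem_head.
  move=> u' v'; rewrite /edge_rel /= !inE !mem_cat => H nsc.
  have memr q : q \in S -> q != (s, c) -> q != (c, s) -> q \in rem p S.
    rewrite (perm_mem pr) inE => /orP[/eqP ->|//].
    by case: pc => ->; rewrite eqxx.
  move: nsc; rewrite negb_or -!xpair_eqE => /andP[n1 n2].
  case/orP: H => /orP[->|h]; rewrite ?orbT //.
    by rewrite (memr _ h) ?orbT.
  rewrite (memr _ h) ?orbT //.
    by apply: contra n2 => /eqP[-> ->].
  by apply: contra n1 => /eqP[-> ->].
- move=> s' s'I; rewrite inE negb_or => /andP[ns s'l].
  have [b'S a'S] := unS s' s'I s'l.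
  have nb : b s' != s.
    by apply/eqP => e; have := lower_notchain s'I sI; rewrite e mem_chain.
  have na : a s' != s.
    by apply/eqP => e; have := upper_notchain s'I sI; rewrite e mem_chain.
  move: b'S a'S; rewrite !(perm_mem pr) !inE.
  rewrite /p; case: ifP => _; rewrite !xpair_eqE ?(negPf nb) ?(negPf na) ?(negPf ns) ?andbF //=.
Qed.

End Chains.

(** The weight bound leaves out the chords [(s, y s)], which become short only in the metric
    obtained by adding new edges. The replaced edges are shorter than [7 * th], so no long edge is
    created from that length on. *)
Lemma contract_exchange : exists (W2 : {set V}) (S : seq (V * V)),
  let L := [seq (s, y s) | s <- enum I] ++ S in
  [/\ W2 \subset W /\ rt \in W2,
      forall p, p \in L -> (p.1 \in W2) && (p.2 \in W2),
      forall v, v \in W2 -> connect (edge_rel L) v rt,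
      forall v, v \in W -> exists2 w, w \in W2 & dl v w < 6 * th &
  \sum_(p <- S) dl p.1 p.2 + 6 * th * #|I|%:R <=
    \sum_(v in W | v != rt) dl v (par v) /\
  forall rho, 7 * th <= rho ->
    (count (fun p => rho <= dl p.1 p.2)%R S <= #|long_edges dl W rt par rho|)%N].
Proof.
have /fin_all_exists[a aP] : forall s, exists a, s \in I ->
    [/\ fconnect par s a, 6 * th <= dl s a, dl s a < 7 * th &
    forall z, fconnect par s z -> fconnect par z a -> z != a -> dl s z < 6 * th].
  move=> s; case sI: (s \in I); last by exists s.
  by have [a] := exists_upper sI; exists a.
have /fin_all_exists[b bP] : forall s, exists b, s \in I ->
    [/\ b \in W, fconnect par b s, 6 * th <= dl s b, dl s b < 7 * th &
    forall z, fconnect par b z -> fconnect par z s -> z != b -> dl s z < 6 * th].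
  move=> s; case sI: (s \in I); last by exists s.
  by have [b] := exists_lower sI; exists b.
have [rtW prt Wpar con] := T.
have [|S [Q [pQ wQ cS unS]]] := @exchange_all a b aP bP (enum I) (enum_uniq _).
  by move=> s; rewrite mem_enum.
pose W2 := [set v in W | proj a b v == v].
have sW s : s \in I -> s \in W by move/(subsetP IW).
have projI s : s \in I -> proj a b s = s.
  by move=> sI; apply: (proj_chain aP bP sI); exact: (mem_chain aP bP).
have projW v : v \in W -> (forall s, s \in I -> v \notin chain a b s) -> v \in W2.
  by move=> vW h; rewrite inE vW proj_id ?eqxx.
have rtW2 : rt \in W2.
  apply: projW => // s sI; apply: contraL rtJ; exact: (chain_notJ aP bP).
have IW2 s : s \in I -> s \in W2.
  by move=> sI; rewrite inE sW ?projI ?eqxx.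
have CW2 p : p \in contracted a b -> (p.1 \in W2) && (p.2 \in W2).
  case: p => u v /contracted_case /= [[uW ur uM ->]|[s sI [-> ->]]|[s sI [-> ->]]].
  - rewrite inE uW notin_merged_proj // eqxx /=; apply: projW; first exact: Wpar.
    by move=> s sI; exact: (unmerged_par aP bP).
  - rewrite (IW2 s sI) andbT; apply: projW; first by case: (bP s sI).
    by move=> s' s'I; exact: (lower_notchain aP bP).
  - rewrite (IW2 s sI) /=; apply: projW => [|s' s'I]; last exact: (upper_notchain aP bP).
    by have [sa _ _ _] := aP s sI; exact: (fconnect_mem T sa (sW s sI)).
exists W2, S; split=> /=.
- by split=> //; apply/subsetP => v; rewrite inE => /andP[].
- move=> p; rewrite mem_cat => /orP[/mapP[s]|pS].
    rewrite mem_enum => sI -> /=; rewrite (IW2 s sI) /=.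
    apply: projW; first exact: yW.
    move=> s' s'I; apply/negP => /(chain_near aP bP s'I); apply/negP.
    by rewrite -leNgt farI.
  by apply: CW2; rewrite (perm_mem pQ) mem_cat pS orbT.
- move=> v; rewrite inE => /andP[vW /eqP pv]; apply: cS.
  by rewrite -pv; exact: (contracted_connect aP bP).
- move=> v vW; have [/existsP[s /andP[sI vc]]|none] :=
      boolP [exists s, (s \in I) && (v \in chain a b s)].
    by exists s; [exact: IW2|rewrite dlC; exact: (chain_near aP bP)].
  exists v; last by rewrite dlvv mulr_gt0.
  apply: projW => // s sI; move/existsPn: none => /(_ s).
  by rewrite sI.
- split.
    apply: le_trans (contracted_weight aP bP).
    by rewrite (perm_big _ pQ) big_cat /= [leRHS]addrC lerD2l cardE.
  move=> rho hrho.
  have : (count (fun p => rho <= dl p.1 p.2)%R S <=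
          count (fun p => rho <= dl p.1 p.2)%R (contracted a b))%N.
    by rewrite (seq.permP pQ) count_cat leq_addl.
  move/leq_trans; apply.
  rewrite /contracted !count_cat !count_map.
  have none (f : V -> V * V) : (forall s, s \in I -> dl (f s).1 (f s).2 < 7 * th) ->
      count (preim f (fun p => rho <= dl p.1 p.2)%R) (enum I) = 0%N.
    move=> h; apply/eqP; rewrite -leqn0 leqNgt -has_count; apply/hasPn => s.
    by rewrite mem_enum => /h lt; rewrite /= -ltNge (lt_le_trans lt).
  rewrite (none (fun s => (b s, s))); last by move=> s /bP[_ _ _ d _]; rewrite /= dlC.
  rewrite (none (fun s => (s, a s))); last by move=> s /aP[].
  rewrite !addn0.
  rewrite -size_filter cardE; apply: uniq_leq_size.
    exact/filter_uniq/enum_uniq.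
  move=> v; rewrite mem_filter !mem_enum !inE /= => /and4P[-> _ -> ->].
  by [].
Qed.
End Contract.

(** For a largest conflict-free [I], each point of [S] lies in [I] or in [f @: I], or is sent into
    [I] by [f]. The points of the last kind outside [I] are again conflict-free, so each of the
    three parts has at most [#|I|] elements. *)
Lemma conflict_free_subset (V : finType) (S : {set V}) (f : V -> V) :
  (forall s, s \in S -> f s != s) ->
  exists I : {set V}, [/\ I \subset S, (#|S| <= 3 * #|I|)%N &
    forall s, s \in I -> f s \notin I].
Proof.
move=> fs; pose ok := [pred I : {set V} | (I \subset S) && [forall s in I, f s \notin I]].
have ok0 : ok set0.
  by rewrite /= sub0set; apply/forall_inP => s; rewrite inE.
case: (@arg_maxnP _ set0 ok (fun I => #|I|) ok0) => I /andP[IS /forall_inP indep] Imax.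
exists I; split=> //.
pose Q := [set s in S :\: I | f s \in I].
have QI : (#|Q| <= #|I|)%N.
  apply: Imax; apply/andP; split.
    by apply/subsetP => s; rewrite !inE => /andP[/andP[]].
  by apply/forall_inP => s; rewrite !inE => /andP[_ ->].
have SU : S \subset I :|: (f @: I :|: Q).
  apply/subsetP => s sS; rewrite !inE sS andbT.
  case: (boolP (s \in I)) => //= sI.
  case: (boolP (s \in f @: I)) => //= sfI.
  apply: contraT => fsI; have := Imax (s |: I); rewrite cardsU1 sI /=.
  suff -> : [forall s0 in s |: I, f s0 \notin s |: I].
    by rewrite subUset sub1set sS IS add1n ltnn => /(_ isT).
  apply/forall_inP => u; rewrite !inE => /orP[/eqP ->|uI].
    by rewrite negb_or fs.
  rewrite negb_or indep // andbT; apply: contra sfI => /eqP <-.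
  exact: imset_f.
have := subset_leq_card SU; have := leq_imset_card f I.
have := cardsU I (f @: I :|: Q); have := cardsU (f @: I) Q.
lia.
Qed.

Lemma maximal_separated (R : realFieldType) (V : finType) (dl : V -> V -> R)
    (r : R) (B : {set V}) : pmetric dl -> 0 < r ->
  exists S : {set V}, [/\ S \subset B,
    forall s s', s \in S -> s' \in S -> s != s' -> r <= dl s s' &
    forall x, x \in B -> exists2 s, s \in S & dl x s < r].
Proof.
move=> [dl0 dlC _] r0.
pose ok := [pred S : {set V} | (S \subset B) &&
  [forall s in S, forall s' in S, (s != s') ==> (r <= dl s s')]].
have ok0 : ok set0.
  by rewrite /= sub0set; apply/forall_inP => s; rewrite inE.
case: (@arg_maxnP _ set0 ok (fun I => #|I|) ok0) => S /andP[SB /forall_inP sep] Smax.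
exists S; split=> // [s s' sS s'S ns|x xB].
  by have /forall_inP/(_ _ s'S)/implyP := sep _ sS; apply.
have [xS|xS] := boolP (x \in S); first by exists x; rewrite ?dl0.
have [/exists_inP[s sS lt]|none] := boolP [exists s in S, dl x s < r].
  by exists s.
have far s : s \in S -> r <= dl x s.
  by move=> sS; rewrite leNgt; apply: contra none => lt; apply/exists_inP; exists s.
have := Smax (x |: S); rewrite cardsU1 xS /= subUset sub1set xB SB /=.
suff -> : [forall s in x |: S, forall s' in x |: S, (s != s') ==> (r <= dl s s')].
  by rewrite add1n ltnn => /(_ isT).
apply/forall_inP => s sxS; apply/forall_inP => s' s'xS; apply/implyP => ns.
move: sxS s'xS; rewrite !inE => /orP[/eqP sx|sS] /orP[/eqP s'x|s'S].
- by rewrite sx s'x eqxx in ns.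
- by rewrite sx far.
- by rewrite s'x dlC far.
- by have /forall_inP/(_ _ s'S)/implyP := sep _ sS; apply.
Qed.

Definition tree_weight (R : realFieldType) (V : finType) (dl : V -> V -> R)
  (W : {set V}) (rt : V) (par : V -> V) := \sum_(v in W | v != rt) dl v (par v).

(** [F] and [P] are found from the current metric [dl]; [dl'] is quantified afterwards because it
    will be the graph metric that includes [F]. The loss of tree weight pays for both [F] and
    [P]. *)
Lemma one_level (R : realFieldType) (V : finType) (d dl : V -> V -> R) (th : R)
    (W : {set V}) (rt : V) (par : V -> V) :
  (forall x y, d x y = d y x) -> pmetric dl -> 0 < th -> rooted_tree W rt par ->
  exists (F : seq (V * V)) (P : {set V}), [/\
  forall p, p \in F -> d p.1 p.2 <= th,
  forall x y, x \in W -> y \in W -> d x y <= th -> dl x y <= 10 * th \/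
    exists p q, [/\ p \in P, q \in P, dl x p <= 15 * th & dl y q <= 15 * th] &
  forall dl', pmetric dl' -> (forall x y, dl' x y <= dl x y) ->
    (forall p, p \in F -> dl' p.1 p.2 <= th) ->
    exists (W' : {set V}) (rt' : V) (par' : V -> V), [/\
      rooted_tree W' rt' par',
      forall w, w \in W -> exists2 w', w' \in W' & dl w w' <= 8 * th,
      th * #|P|%:R <= 3 * (tree_weight dl W rt par - tree_weight dl' W' rt' par')
        + th * (1 + 4 * #|long_edges dl W rt par th|%:R),
      th * (size F)%:R <= tree_weight dl W rt par - tree_weight dl' W' rt' par' &
      forall rho, 7 * th <= rho -> (#|long_edges dl' W' rt' par' rho| <=
        #|long_edges dl W rt par rho|)%N]].
Proof.
move=> dC dm th0 T; have [dl0 dlC dlD] := dm.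
have lge0 x y : 0 <= dl x y by exact: pmetric_ge0.
have [W1 [W1W T1 hat lvP]] := trim dm th0 T.
have /fin_all_exists[h hP] : forall w, exists w', w \in W -> w' \in W1 /\ dl w w' < 2 * th.
  move=> w; case wW: (w \in W); last by exists w.
  by have [w' ? ?] := hat w wW; exists w'.
pose Lg := long_edges dl W rt par th; pose Lg1 := long_edges dl W1 rt par th.
pose Lv := leaves W1 rt par; pose Lt := Lv :\: Lg.
pose J := rt |: (branchings W1 rt par :|: (Lv :|: (Lg1 :|: par @: Lg1))).
have rtJ : rt \in J by rewrite !inE eqxx.
have Lg1Lg : Lg1 \subset Lg.
  by apply/subsetP => v; rewrite !inE => /and3P[/(subsetP W1W) -> -> ->].
(* There are at most as many branching points as leaves, at most [#|Lt| + #|Lg|] leaves, and two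
   ends for each long edge. *)
have cardJ : (#|J| <= 1 + 2 * #|Lt| + 4 * #|Lg|)%N.
  have c1 := card_branchings T1.
  have c2 : (#|Lv| <= #|Lt| + #|Lg|)%N.
    rewrite -(cardsID Lg Lv) addnC leq_add2l.
    by rewrite subset_leq_card // subsetIr.
  have c3 := leq_imset_card par Lg1; have c4 := subset_leq_card Lg1Lg.
  rewrite cardsU1; move: (_ \notin _) => nb.
  have := leq_b1 nb.
  have := cardsU (branchings W1 rt par) (Lv :|: (Lg1 :|: par @: Lg1)).
  have := cardsU Lv (Lg1 :|: par @: Lg1); have := cardsU Lg1 (par @: Lg1).
  rewrite -/Lv in c1; lia.
pose free s := [forall j in J, 6 * th <= dl s j].
pose bad s (q : V * V) := [&& q.1 \in W, q.2 \in W, d q.1 q.2 <= th,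
  10 * th < dl q.1 q.2 & h q.1 == s].
pose B := [set s in W1 | free s && [exists q, bad s q]].
have th13 : 0 < 13 * th by rewrite mulr_gt0.
have [S [SB sep cov]] := maximal_separated B dm th13.
have /fin_all_exists[wit witP] : forall s, exists q, s \in B -> bad s q.
  move=> s; case: (boolP (s \in B)) => [|_]; last by exists (s, s).
  by rewrite inE => /and3P[_ _ /existsP[q bq]]; exists q.
pose y s := h (wit s).2.
have yB s : s \in B -> [/\ y s \in W1, dl s (wit s).1 < 2 * th,
    dl (wit s).2 (y s) < 2 * th & 6 * th <= dl s (y s)].
  move=> /witP/and5P[w1 w2 _ far /eqP hs].
  have [_ d1] := hP _ w1; have [yW1 d2] := hP _ w2; rewrite hs in d1.
  split=> //; first by rewrite dlC.
  rewrite -/(y s) in d2 yW1 *.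
  have := dlD (wit s).1 s (wit s).2; have := dlD s (y s) (wit s).2.
  by rewrite (dlC (y s)); move: far d1 d2; clear; lra.
(* The point of [S] within [6 * th] of the partner of [s], unique since the points of [S] are
   [13 * th] apart. The default [rt] is in [J], hence differs from all points of [S]. *)
pose f s := odflt rt [pick s' in S | dl s' (y s) < 6 * th].
have SJ s j : s \in S -> j \in J -> 6 * th <= dl s j.
  by move/(subsetP SB); rewrite inE => /and3P[_ /forall_inP + _] => h1; exact: h1.
have fs s : s \in S -> f s != s.
  move=> sS; rewrite /f; case: pickP => [s' /andP[s'S lt]|_] /=.
    apply: contraTneq lt => ->; rewrite -leNgt.
    by have [] := yB s (subsetP SB _ sS).
  apply/eqP => e; have := SJ s rt sS rtJ.
  by rewrite e dl0 leNgt mulr_gt0.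
have [I [IS cardI indep]] := conflict_free_subset fs.
have IB s : s \in I -> s \in B by move=> sI; apply/(subsetP SB)/(subsetP IS).
have th_lt (a b : nat) : (a < b)%N -> a%:R * th < b%:R * th.
  by move=> ab; rewrite ltr_pM2r // ltr_nat.
have farI s s' : s \in I -> s' \in I -> 6 * th <= dl s' (y s).
  move=> sI s'I; rewrite leNgt; apply/negP => lt.
  have := indep s sI => /negP; apply.
  rewrite /f; case: pickP => [u /andP[uS ult]|/(_ s')]; last first.
    by rewrite (subsetP IS _ s'I) lt.
  rewrite /=; suff -> : u = s' by [].
  apply/eqP/negPn/negP => /(sep u s' uS (subsetP IS _ s'I)).
  have := dlD u (y s) s'; rewrite (dlC (y s)); move: th0 lt ult; clear; lra.
have IW1 : I \subset W1.
  by apply/subsetP => s /IB; rewrite inE => /andP[].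
have yW1 s : s \in I -> y s \in W1 by move=> /IB/yB[].
have brJ : branchings W1 rt par \subset J.
  by apply/subsetP => v vb; rewrite in_setU1 in_setU vb orbT.
have lvJ : leaves W1 rt par \subset J.
  by apply/subsetP => v vb; rewrite in_setU1 !in_setU vb !orbT.
have lgJ v : v \in Lg1 -> v \in J /\ par v \in J.
  by move=> vL; rewrite !in_setU1 !in_setU vL imset_f ?orbT.
have freeI s j : s \in I -> j \in J -> 6 * th <= dl s j.
  by move=> sI; apply: SJ; exact: (subsetP IS).
have sepI s s' : s \in I -> s' \in I -> s != s' -> 13 * th <= dl s s'.
  by move=> sI s'I; apply: sep; exact: (subsetP IS).
have [W2 [S0 [[W2W rtW2] LW2 con dom [wS0 cS0]]]] :=
  contract_exchange dm th0 T1 IW1 yW1 rtJ brJ lvJ lgJ freeI sepI farI.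
(* Chords are added for [I] only, but all of [S] enters the net; [#|S| <= 3 * #|I|] is the source of
   the factor 3. *)
exists [seq wit s | s <- enum I], (J :|: S); split.
- by move=> p /mapP[s]; rewrite mem_enum => /IB/witP/and5P[_ _ + _ _] ->.
(* Moving to [W1] costs [2 * th]; from there a point of [J] is within [6 * th] or a point of [S]
   within [13 * th], whence 15. *)
- have near x z : x \in W -> z \in W -> d x z <= th -> 10 * th < dl x z ->
      exists2 p, p \in J :|: S & dl x p <= 15 * th.
    move=> xW zW dxz far; have [hW1 dh] := hP x xW.
    have [fr|/forall_inPn[j jJ]] := boolP (free (h x)).
      have [|s sS lt] := cov (h x).
        by rewrite inE hW1 fr; apply/existsP; exists (x, z); rewrite /bad xW zW dxz far eqxx.
      exists s; first by rewrite inE sS orbT.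
      have := dlD x (h x) s; move: lt dh; clear; lra.
    rewrite -ltNge => lt; exists j; first by rewrite inE jJ.
    have := dlD x (h x) j; move: th0 lt dh; clear; lra.
  move=> x z xW zW dxz; case: (leP (dl x z) (10 * th)) => far; [by left|right].
  have [p pP dp] := near x z xW zW dxz far.
  have [q qP dq] : exists2 p, p \in J :|: S & dl z p <= 15 * th.
    by apply: (near z x) => //; [rewrite dC|rewrite dlC].
  by exists p, q.
move=> dl' dm' dl'dl dl'F; have [dl'0 dl'C dl'D] := dm'.
have chord s : s \in I -> dl' s (y s) < 5 * th.
  move=> sI; have [_ d1 d2 _] := yB s (IB s sI).
  have d3 : dl' (wit s).1 (wit s).2 <= th.
    by apply: dl'F; apply: map_f; rewrite mem_enum.
  have := dl'D s (wit s).1 (y s); have := dl'D (wit s).1 (wit s).2 (y s).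
  have := dl'dl s (wit s).1; have := dl'dl (wit s).2 (y s).
  move: d1 d2 d3; clear; lra.
have [par' [T' wT']] := rooted_spanning_tree R rtW2 LW2 con.
have w1 := trim_weight dm T W1W T1 lvP.
(* Trimming saves [th] for each leaf in [Lt], and each exchange trades an edge of length at least
   [6 * th] for a chord of at most [5 * th]. *)
have w2 : tree_weight dl' W2 rt par' + th * #|Lt|%:R + th * #|I|%:R <=
    tree_weight dl W rt par.
  have := wT' dl' dl'C (fun x y => pmetric_ge0 x y dm').
  rewrite big_cat big_map big_enum /= -/(tree_weight dl' W2 rt par').
  have chords : \sum_(s in I) dl' s (y s) <= 5 * th * #|I|%:R.
    by rewrite mulr_natr -sumr_const; apply: ler_sum => s sI; exact/ltW/chord.
  have olds : \sum_(p <- S0) dl' p.1 p.2 <= \sum_(p <- S0) dl p.1 p.2.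
    by apply: ler_sum => p _; exact: dl'dl.
  rewrite -/Lv -/Lg -/Lt in w1.
  rewrite /tree_weight; move: chords olds wS0 w1; clear; lra.
exists W2, rt, par'; split=> //.
- move=> w wW; have [hW1 dh] := hP w wW; have [v vW2 dv] := dom _ hW1.
  exists v => //; have := dlD w (h w) v; move: dh dv; clear; lra.
- have cJS : #|J :|: S|%:R <= 1 + 2 * #|Lt|%:R + 4 * #|Lg|%:R + 3 * #|I|%:R :> R.
    rewrite -!natrM nat1r -!natrD ler_nat.
    have cU : (#|J :|: S| <= #|J| + #|S|)%N by rewrite cardsU leq_subr.
    move: cU cardJ cardI; move: (#|J :|: S|) (#|J|) (#|S|) (#|I|) (#|Lt|) (#|Lg|).
    by clear; lia.
  rewrite -/Lg; have : th * #|J :|: S|%:R <=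
    th * (1 + 2 * #|Lt|%:R + 4 * #|Lg|%:R + 3 * #|I|%:R) by rewrite ler_pM2l.
  have : 0 <= th * #|Lt|%:R by rewrite mulr_ge0 ?ler0n // ltW.
  rewrite !mulrDr; move: w2; clear; lra.
- rewrite size_map -cardE.
  have : 0 <= th * #|Lt|%:R by rewrite mulr_ge0 ?ler0n // ltW.
  move: w2; clear; lra.
move=> rho hrho.
pose g u v : R := (rho <= dl' u v)%R%:R.
have gC u v : g u v = g v u by rewrite /g dl'C.
have := wT' g gC (fun u v => ler0n _ _).
rewrite big_cat big_map big_enum /=.
have -> : \sum_(s in I) g s (y s) = 0.
  apply: big1 => s sI; rewrite /g leNgt (lt_le_trans (chord s sI)) //.
  by apply: le_trans hrho; rewrite ler_pM2r // ler_nat.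
rewrite add0r.
have cnt : \sum_(p <- S0) g p.1 p.2 <= (#|long_edges dl W rt par rho|)%:R.
  apply: (@le_trans _ _ (\sum_(p <- S0) (rho <= dl p.1 p.2)%R%:R)).
    apply: ler_sum => p _; rewrite /g ler_nat.
    by case: leP => //= h1; rewrite (le_trans h1).
  rewrite -natr_sum ler_nat; have := cS0 rho hrho.
  have -> : (\sum_(p <- S0) (rho <= dl p.1 p.2)%R)%N = count (fun p => rho <= dl p.1 p.2)%R S0.
    by rewrite -sum1_count [RHS]big_mkcond /=; apply: eq_bigr => p _; case: ifP.
  move/leq_trans; apply; apply: subset_leq_card; apply/subsetP => v.
  by rewrite !inE => /and3P[/(subsetP W1W) -> -> ->].
move=> /le_trans/(_ cnt).
rewrite -natr_sum ler_nat; apply: leq_trans.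
rewrite -sum1_card big_mkcond [leqRHS]big_mkcond /=; apply: leq_sum => v _.
by rewrite inE; case: (v \in W2) => //=; case: (v != rt).
Qed.

(** * Walk distances and amortized nets *)

Section WalkDistance.
Variables (R : realType) (V : finType) (d : V -> V -> R).
Hypothesis dm : pmetric d.

Let d0 x y : 0 <= d x y. Proof. exact: pmetric_ge0. Qed.

Lemma walk_weight_ge0 x s : 0 <= walk_weight d x s.
Proof. by elim: s x => //= y s IH x; rewrite addr_ge0. Qed.

Lemma walk_weight_cat x s s' :
  walk_weight d x (s ++ s') = walk_weight d x s + walk_weight d (last x s) s'.
Proof. by elim: s x => [|y s IH] x /=; rewrite ?add0r // IH addrA. Qed.

Lemma le_walk_weight x s : d x (last x s) <= walk_weight d x s.
Proof.
have [dxx _ dt] := dm; elim: s x => [|y s IH] x /=; first by rewrite dxx.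
by apply: le_trans (dt x y _) _; rewrite lerD2l.
Qed.

Lemma walk_weight_rev x s :
  walk_weight d (last x s) (rev (belast x s)) = walk_weight d x s.
Proof.
have [_ dC _] := dm; elim: s x => //= y s IH x.
rewrite rev_cons -cats1 walk_weight_cat IH /= addr0 addrC dC; congr (d _ _ + _).
by case: s {IH} => //= z s; rewrite rev_cons last_rcons.
Qed.

(** Real-valued counterpart of [graph_dist] for a relation. The infimum carries information only
    when some walk exists, so connectedness is assumed for most facts about it. *)
Definition walk_dist (e : rel V) (x y : V) : R :=
  inf [set walk_weight d x s | s in [set s : seq V | path e x s /\ last x s = y]]%classic.

Lemma walk_lbound (e : rel V) x y : has_lbound
  [set walk_weight d x s | s in [set s : seq V | path e x s /\ last x s = y]]%classic.
Proof. by exists 0 => _ /= [s _ <-]; exact: walk_weight_ge0. Qed.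

Lemma walk_dist_le (e : rel V) x s :
  path e x s -> walk_dist e x (last x s) <= walk_weight d x s.
Proof. by move=> p; apply: ge_inf; [exact: walk_lbound|exists s]. Qed.

Section Connected.
Variable e : rel V.
Hypotheses (es : symmetric e) (con : forall x y, connect e x y).

Lemma walks_neq0 x y : ([set walk_weight d x s | s in
   [set s : seq V | path e x s /\ last x s = y]] !=set0)%classic.
Proof.
by have /connectP[s p ->] := con x y; exists (walk_weight d x s); exists s.
Qed.

Lemma walk_dist_adherent x y eps : 0 < eps -> exists s,
  [/\ path e x s, last x s = y & walk_weight d x s < walk_dist e x y + eps].
Proof.
move=> eps0; have [] := inf_adherent (E := [set walk_weight d x s | s in
   [set s : seq V | path e x s /\ last x s = y]]%classic) eps0.
  by split; [exact: walks_neq0|exact: walk_lbound].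
by move=> _ [s [ps ls] <-] lt; exists s.
Qed.

Lemma walk_dist_ge0 x y : 0 <= walk_dist e x y.
Proof.
apply: lb_le_inf; first exact: walks_neq0.
by move=> _ [s _ <-]; exact: walk_weight_ge0.
Qed.

Lemma le_walk_dist x y : d x y <= walk_dist e x y.
Proof.
apply: lb_le_inf; first exact: walks_neq0.
by move=> _ [s [_ <-] <-]; exact: le_walk_weight.
Qed.

Lemma walk_dist_edge x y : e x y -> walk_dist e x y <= d x y.
Proof.
by move=> exy; have := @walk_dist_le e x [:: y]; rewrite /= exy addr0; exact.
Qed.

Lemma walk_dist_pmetric : pmetric (walk_dist e).
Proof.
split.
- move=> x; apply/eqP; rewrite eq_le walk_dist_ge0 andbT.
  by have := @walk_dist_le e x [::]; exact.
- have half x y : walk_dist e y x <= walk_dist e x y.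
    apply/ler_addgt0Pr => eps eps0; have [s [ps <- /ltW]] := walk_dist_adherent x y eps0.
    apply: le_trans; rewrite -walk_weight_rev.
    have h : last (last x s) (rev (belast x s)) = x.
      by case: s {ps} => //= y' s; rewrite rev_cons last_rcons.
    rewrite -{2}h; apply: walk_dist_le.
    by rewrite rev_path; under eq_path do rewrite es.
  by move=> x y; apply/eqP; rewrite eq_le !half.
- move=> x y z; apply/ler_addgt0Pr => eps eps0.
  have e2 : 0 < eps / 2 by rewrite divr_gt0.
  have [s [ps ls ws]] := walk_dist_adherent x y e2.
  have [s' [ps' ls' ws']] := walk_dist_adherent y z e2.
  have pc : path e x (s ++ s') by rewrite cat_path ps ls.
  have := walk_dist_le pc; rewrite last_cat walk_weight_cat ls ls'.
  by move: ws ws'; clear; lra.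
Qed.

Lemma graph_dist_le (H : graph V) x y : (forall u v, e u v -> adj H u v) ->
  (graph_dist d H x y <= (walk_dist e x y)%:E)%E.
Proof.
move=> eH; rewrite -ereal_inf_EFin; [|exact: walk_lbound|exact: walks_neq0].
apply: ereal_inf_le_tmp => _ [_ [s [ps ls] <-] <-]; exists s => //.
by split => //; apply: sub_path ps.
Qed.

End Connected.

Lemma walk_dist_mono (e e' : rel V) x y : (forall x y, connect e x y) ->
  (forall u v, e u v -> e' u v) -> walk_dist e' x y <= walk_dist e x y.
Proof.
move=> con ee; apply: lb_le_inf; first exact: walks_neq0.
by move=> _ [s [ps <-] <-]; apply: walk_dist_le; exact: sub_path ps.
Qed.

End WalkDistance.

(** * Induction over the scales *)

Lemma edge_rel_catl (V : finType) (L L' : seq (V * V)) u v :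
  edge_rel L u v -> edge_rel (L ++ L') u v.
Proof. by rewrite /edge_rel /= !mem_cat => /orP[] ->; rewrite ?orbT. Qed.

Lemma amortized_nets (R : realType) (V : finType) (d : V -> V -> R)
    (ET : seq (V * V)) (rt : V) (th0 : R) (m : nat) :
  pmetric d -> (forall x y, connect (edge_rel ET) x y) -> 0 < th0 ->
  let th j := th0 * 33 ^+ j in
  let wT := \sum_(p <- ET) d p.1 p.2 in
  exists (F : seq (V * V)) (P : nat -> {set V}),
    let dl := walk_dist d (edge_rel (ET ++ F)) in
  [/\ \sum_(p <- F) d p.1 p.2 <= wT,
      \sum_(j < m) th j * #|P j|%:R <= 3 * wT + \sum_(j < m) th j *
        (1 + 4 * (count (fun p => th j <= d p.1 p.2)%R ET)%:R) &
      forall j x y, (j < m)%N -> d x y <= th j / 2 -> dl x y <= 11 * th j \/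
        exists p q, [/\ p \in P j, q \in P j, dl x p <= 16 * th j &
          dl y q <= 16 * th j]].
Proof.
move=> dm con th00 th wT; have [dxx dC dD] := dm.
have d0 x y : 0 <= d x y by exact: pmetric_ge0.
have th_gt0 j : 0 < th j by rewrite mulr_gt0 ?exprn_gt0.
have thS j : th j.+1 = 33 * th j by rewrite /th exprS mulrCA.
pose dist F := walk_dist d (edge_rel (ET ++ F)).
have conF F x y : connect (edge_rel (ET ++ F)) x y.
  apply: connect_sub (con x y) => u v uv; apply: connect1; exact: edge_rel_catl.
have dmF F : pmetric (dist F).
  by apply: walk_dist_pmetric => //; exact: edge_rel_sym.
have ledF F x y : d x y <= dist F x y by apply: le_walk_dist.
have monoF F F' x y : dist (F ++ F') x y <= dist F x y.
  by apply: walk_dist_mono => // u v; rewrite catA; exact: edge_rel_catl.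
have edgeF F p : p \in ET ++ F -> dist F p.1 p.2 <= d p.1 p.2.
  by move=> pF; apply: walk_dist_edge => //; rewrite /edge_rel /= -surjective_pairing pF.
pose N rho := count (fun p => rho <= d p.1 p.2)%R ET.
(* The invariant is a tree whose weight serves as potential, on a set [W] that meets every ball of
   radius [th m / 4]. One scale moves points by a further [8 * th m], and 1/4 + 8 = 33/4: this fixes
   the ratio 33 of the scales. *)
suff [F [P [W [rt' [par [T dom wF wP [lng cov]]]]]]] : exists (F : seq (V * V))
    (P : nat -> {set V}) (W : {set V}) (rt' : V) (par : V -> V),
  [/\ rooted_tree W rt' par,
      forall v, exists2 w, w \in W & dist F v w <= th m / 4,
      \sum_(p <- F) d p.1 p.2 + tree_weight (dist F) W rt' par <= wT,
      \sum_(j < m) th j * #|P j|%:R + 3 * tree_weight (dist F) W rt' par <=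
        3 * wT + \sum_(j < m) th j * (1 + 4 * (N (th j))%:R) &
      (forall rho, th m <= rho ->
        (#|long_edges (dist F) W rt' par rho| <= N rho)%N) /\
      (forall j x y, (j < m)%N -> d x y <= th j / 2 -> dist F x y <= 11 * th j \/
        exists p q, [/\ p \in P j, q \in P j, dist F x p <= 16 * th j &
          dist F y q <= 16 * th j])].
  have tw0 : 0 <= tree_weight (dist F) W rt' par.
    by apply: sumr_ge0 => v _; exact: pmetric_ge0.
  exists F, P; split=> //.
    by move: wF tw0; clear; lra.
  by move: wP tw0; clear; rewrite -/(N _) -/wT; lra.
elim: m => [|m [F [P [W [rt' [par [T dom wF wP [lng cov]]]]]]]].
  have [|||par [T wg]] := @rooted_spanning_tree R V ET [set: V] rt; rewrite ?inE //.
    by move=> p; rewrite !inE.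
  exists [::], (fun=> finset.set0), [set: V], rt, par; split=> //.
  - move=> v; exists v; rewrite ?inE //.
    by have [-> _ _] := dmF [::]; rewrite divr_ge0 // ltW.
  - rewrite big_nil add0r; apply: le_trans (wg _ _ _) _.
    + by case: (dmF [::]).
    + by move=> x y; exact: pmetric_ge0.
    rewrite /wT; rewrite big_seq [leRHS]big_seq; apply: ler_sum => p pE.
    by apply: edgeF; rewrite cats0.
  - rewrite !big_ord0 add0r addr0 ler_pM2l //.
    apply: le_trans (wg _ _ _) _.
    + by case: (dmF [::]).
    + by move=> x y; exact: pmetric_ge0.
    rewrite /wT; rewrite big_seq [leRHS]big_seq; apply: ler_sum => p pE.
    by apply: edgeF; rewrite cats0.
  - split=> // rho _.
    have gC u v : ((rho <= dist [::] u v)%R%:R = (rho <= dist [::] v u)%R%:R :> R).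
      by case: (dmF [::]) => _ -> _.
    have := wg _ gC (fun u v => ler0n _ _).
    have le : \sum_(p <- ET) (rho <= dist [::] p.1 p.2)%R%:R <= (N rho)%:R :> R.
      rewrite /N -sum1_count natr_sum [leRHS]big_mkcond big_seq [leRHS]big_seq.
      apply: ler_sum => p pE; have := edgeF [::] p; rewrite cats0 => /(_ pE) h.
      by case: (boolP (rho <= dist [::] p.1 p.2)) => [h1|_]; [rewrite (le_trans h1 h)|case: ifP].
    move=> /le_trans/(_ le); rewrite -natr_sum ler_nat; apply: leq_trans.
    rewrite -sum1_card big_mkcond [leqRHS]big_mkcond /=; apply: leq_sum => v _.
    by rewrite inE; case: (v \in _) => //=; case: (v != rt).
have [F1 [P1 [dF1 cov1 next]]] := one_level dC (dmF F) (th_gt0 m) T.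
have [|W' [rt2 [par' [T' dom' wP' wF' lng']]]] :=
  next (dist (F ++ F1)) (dmF _) (monoF F F1).
  by move=> p pF1; apply: le_trans (dF1 p pF1); apply: edgeF; rewrite !mem_cat pF1 !orbT.
pose P' j := if j == m then P1 else P j.
have thm := th_gt0 m.
exists (F ++ F1), P', W', rt2, par'; split=> //.
- move=> v; have [w wW vw] := dom v; have [w' w'W ww'] := dom' w wW.
  exists w' => //; have [_ _ dt] := dmF (F ++ F1); have := dt v w w'.
  rewrite thS; have := monoF F F1 v w; have := monoF F F1 w w'.
  by move: vw ww'; clear; lra.
- rewrite big_cat /=.
  have : \sum_(p <- F1) d p.1 p.2 <= th m * (size F1)%:R.
    rewrite -sum1_size natr_sum mulr_sumr big_seq [leRHS]big_seq.
    by apply: ler_sum => p pF1; rewrite mulr1 dF1.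
  by move: wF wF'; clear; lra.
- rewrite !big_ord_recr /= {2}/P' eqxx.
  rewrite (eq_bigr (fun j : 'I_m => th j * #|P j|%:R)); last first.
    by move=> j _; rewrite /P' ltn_eqF.
  have lN := lng (th m) (lexx _).
  have : th m * (1 + 4 * #|long_edges (dist F) W rt' par (th m)|%:R) <=
         th m * (1 + 4 * (N (th m))%:R).
    by rewrite ler_pM2l // lerD2l ler_pM2l // ler_nat.
  by move: wP wP'; clear; lra.
- split=> [rho hr|j x y].
    have hr' : 7 * th m <= rho.
      by move: hr thm; rewrite thS; clear; lra.
    apply: leq_trans (lng' rho hr') (lng _ _).
    by move: hr' thm; clear; lra.
  rewrite ltnS leq_eqVlt => /orP[/eqP ->|jm] dxy; last first.
    rewrite /P' ltn_eqF //; have [le|[p [q [pP qP xp yq]]]] := cov j x y jm dxy.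
      by left; apply: le_trans le; exact: monoF.
    by right; exists p, q; split=> //; apply: le_trans (monoF _ _ _ _) _.
  rewrite /P' eqxx; have [x' x'W xx'] := dom x; have [y' y'W yy'] := dom y.
  have [_ dlC dlD] := dmF F.
  (* 1/2 + 1/4 + 1/4 = 1. The two moves into [W] also turn the constants 10 and 15 of one scale into
     11 and 16. *)
  have dx'y' : d x' y' <= th m.
    have := dD x' x y'; have := dD x y y'; rewrite (dC x' x).
    have := ledF F x x'; have := ledF F y y'.
    by move: dxy xx' yy'; clear; lra.
  have [le|[p [q [pP qP xp yq]]]] := cov1 x' y' x'W y'W dx'y'.
    left; apply: le_trans (monoF _ _ _ _) _.
    have := dlD x x' y; have := dlD x' y' y; rewrite (dlC y' y).
    by move: le xx' yy' thm; clear; lra.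
  right; exists p, q; split=> //; apply: le_trans (monoF _ _ _ _) _.
    by have := dlD x x' p; move: xp xx' thm; clear; lra.
  by have := dlD y y' q; move: yq yy' thm; clear; lra.
Qed.

(** * Clusters from nonnegative features *)

(* Layer cake: g is a nonnegative combination of indicators of its level sets. *)
Lemma level_set_positive (R : realFieldType) (V : finType) (c : V -> V -> R)
    (g : V -> R) : (forall x, 0 <= g x) ->
  0 < \sum_a \sum_b c a b * Num.min (g a) (g b) ->
  exists L : {set V}, 0 < \sum_(a in L) \sum_(b in L) c a b.
Proof.
have [n] := ubnP #|[set x | 0 < g x]|; elim: n g => // n IH g ltn g0 pos.
pose S := [set x | 0 < g x]; have notS x : x \notin S -> g x = 0.
  by rewrite inE -leNgt => le; apply/eqP; rewrite eq_le le g0.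
case: (set_0Vmem S) => [S0|[x0 x0S]].
  move: pos; rewrite big1 ?ltxx // => a _; rewrite big1 // => b _.
  by rewrite !notS ?S0 ?inE // minxx mulr0.
have [m mS mmin] := @arg_minP _ _ _ x0 (fun x => x \in S) g x0S.
pose g' x := if x \in S then g x - g m else 0.
have g'0 x : 0 <= g' x.
  by rewrite /g'; case: ifP => // xS; rewrite subr_ge0 mmin.
have split a b : Num.min (g a) (g b) =
    g m * ((a \in S) && (b \in S))%:R + Num.min (g' a) (g' b).
  rewrite /g'; case: (boolP (a \in S)) => aS; case: (boolP (b \in S)) => bS /=.
  - by rewrite mulr1 addr_minr ![g m + _]addrC !subrK.
  - by rewrite (notS b bS) mulr0 add0r !min_r ?subr_ge0 ?mmin // g0.
  - by rewrite (notS a aS) mulr0 add0r !min_l ?subr_ge0 ?mmin // g0.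
  - by rewrite (notS a aS) (notS b bS) mulr0 add0r.
have decomp : \sum_a \sum_b c a b * Num.min (g a) (g b) =
    g m * \sum_(a in S) \sum_(b in S) c a b +
    \sum_a \sum_b c a b * Num.min (g' a) (g' b).
  rewrite mulr_sumr [X in X + _]big_mkcond -big_split /=; apply: eq_bigr => a _.
  under eq_bigr => b _ do rewrite split mulrDr.
  rewrite big_split /=; congr (_ + _); case: ifP => aS /=.
    rewrite mulr_sumr [RHS]big_mkcond /=; apply: eq_bigr => b _.
    by case: ifP => _; rewrite ?mulr1 ?mulr0 // mulrC.
  by rewrite big1 // => b _; rewrite mulr0 mulr0.
have [posS|negS] := ltP 0 (\sum_(a in S) \sum_(b in S) c a b); first by exists S.
apply: (IH g') => //.
  apply: leq_trans (_ : #|S| <= n)%N; last by rewrite -ltnS.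
  apply: proper_card; apply/properP; split.
    apply/subsetP => x; rewrite inE /g'; case: ifP => //.
    by rewrite ltxx.
  by exists m => //; rewrite inE /g' mS subrr ltxx.
apply: lt_le_trans pos _; rewrite decomp gerDr mulr_ge0_le0 //.
Qed.

Section ClusterStep.
Variables (R : realFieldType) (V Om : finType) (P : {set V}) (E : {set V * V}).
Variables (far : rel V) (h : Om -> V -> R) (k : V -> V -> R) (Z dl ep : R).
Hypotheses (EP : forall a b, (a, b) \in E -> (a \in P) && (b \in P)).
Hypotheses (h0 : forall w x, 0 <= h w x) (Z0 : 0 < Z) (dl0 : 0 < dl).
Hypothesis hk : forall x y, \sum_w h w x * h w y = Z * k x y.
Hypothesis kxx : forall x, k x x = 1.
Hypothesis kE : forall a b, (a, b) \in E -> dl <= k a b.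
Hypothesis kfar : forall a b, far a b -> k a b <= ep.
Hypothesis ep0 : 0 <= ep.
Hypothesis ep_dl : 8 * #|P|%:R * ep < dl ^+ 2.

(** Level sets of the squared features see minima, not products. Passing to minima costs a square:
    [M] is at least [Z * dl ^+ 2 / 2] on [E], and at most [Z * ep] on far pairs. *)
Let M a b := \sum_w Num.min (h w a ^+ 2) (h w b ^+ 2).

Let Maa a : M a a = Z.
Proof. by rewrite /M; under eq_bigr => w _ do rewrite minxx expr2; rewrite hk kxx mulr1. Qed.

Lemma min_sqr_ge a b : (a, b) \in E -> Z * dl ^+ 2 / 2 <= M a b.
Proof.
move=> abE; have kab := kE abE.
(* AM-GM: with m <= M the two values, m M <= m^2 / dl + (dl / 4) M^2. *)
have amgm w : h w a * h w b <= dl^-1 * Num.min (h w a ^+ 2) (h w b ^+ 2) +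
    dl / 4 * (h w a ^+ 2 + h w b ^+ 2).
  have key (x y : R) : x * y <= dl^-1 * x ^+ 2 + dl / 4 * (x ^+ 2 + y ^+ 2).
    have : 0 <= dl^-1 * (x - dl / 2 * y) ^+ 2.
      by rewrite mulr_ge0 ?sqr_ge0 // invr_ge0 ltW.
    have -> : dl^-1 * (x - dl / 2 * y) ^+ 2 =
        dl^-1 * x ^+ 2 - x * y + dl / 4 * y ^+ 2.
      by field; rewrite gt_eqF.
    have : 0 <= dl / 4 * x ^+ 2 by rewrite mulr_ge0 ?sqr_ge0 // divr_ge0 // ltW.
    by rewrite [dl / 4 * (_ + _)]mulrDr => *; lra.
  case: (leP (h w a ^+ 2) (h w b ^+ 2)) => _; first exact: key.
  by rewrite mulrC [X in dl / 4 * X]addrC; exact: key.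
have : Z * k a b <= dl^-1 * M a b + dl / 4 * (Z + Z).
  have sq x : \sum_w h w x ^+ 2 = Z.
    by under eq_bigr => w _ do rewrite expr2; rewrite hk kxx mulr1.
  rewrite -hk -{1}(sq a) -{1}(sq b) -big_split /= /M !mulr_sumr -big_split /=.
  by apply: ler_sum => w _; exact: amgm.
have : Z * dl <= Z * k a b by rewrite ler_pM2l.
move=> l1 l2; rewrite -(ler_pM2l (x := dl^-1)) ?invr_gt0 //.
have -> : dl^-1 * (Z * dl ^+ 2 / 2) = Z * dl / 2 by field; rewrite gt_eqF.
by move: l1 l2; have -> : dl / 4 * (Z + Z) = Z * dl / 2; [field|lra].
Qed.

Lemma min_sqr_far a b : far a b -> M a b <= Z * ep.
Proof.
move=> fab; apply: le_trans (_ : Z * k a b <= _); last by rewrite ler_pM2l ?kfar.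
rewrite -hk; apply: ler_sum => w _; rewrite ge_min !expr2.
have [le|/ltW le] := leP (h w a) (h w b).
  by rewrite ler_wpM2l.
by rewrite orbC ler_wpM2r.
Qed.

Let e a b : R := ((a, b) \in E)%:R.
Let deg a : R := \sum_b e a b + \sum_b e b a.
Let N : R := #|E|%:R.

Let NE : \sum_a \sum_b e a b = N.
Proof.
rewrite /N -sum1_card natr_sum pair_big [RHS]big_mkcond /=; apply: eq_bigr => -[a b] _.
by rewrite /e /=; case: ifP.
Qed.

(* Counts the pairs of E in a level set, less those spoilt by a far partner of
   one end and less a share proportional to the size of the level set. *)
Let cost a b : R := if (a \in P) && (b \in P) then
  e a b - (far a b)%:R * deg a - (a == b)%:R * (dl ^+ 2 / 4 * N / #|P|%:R) else 0.

(** Summed over all features, the pairs of [E] give at least [N * Z * dl ^+ 2 / 2], the far pairs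
    take at most [2 * N * #|P|%:R * Z * ep], and the share for the size takes [N * Z * dl ^+ 2 / 4].
    By [ep_dl] a positive amount is left. *)
Lemma cost_positive : E != set0 ->
  0 < \sum_w \sum_a \sum_b cost a b * Num.min (h w a ^+ 2) (h w b ^+ 2).
Proof.
case/set0Pn=> -[a0 b0] abE; have /andP[a0P _] := EP abE.
have P0 : 0 < #|P|%:R :> R by rewrite ltr0n; apply/card_gt0P; exists a0.
have N0 : 0 < N by rewrite ltr0n; apply/card_gt0P; exists (a0, b0).
have deg0 a : 0 <= deg a by rewrite addr_ge0 // sumr_ge0 // => *; exact: ler0n.
have degsum : \sum_a deg a = 2 * N.
  by rewrite big_split /= NE exchange_big NE; lra.
rewrite exchange_big /=; under eq_bigr => a _ do rewrite exchange_big /=.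
rewrite (eq_bigr (fun a => \sum_b cost a b * M a b)); last first.
  by move=> a _; apply: eq_bigr => b _; rewrite mulr_sumr.
have M0 a b : 0 <= M a b.
  by apply: sumr_ge0 => w _; rewrite le_min !sqr_ge0.
set ka := dl ^+ 2 / 4 * N / #|P|%:R; have ka0 : 0 <= ka.
  by rewrite !mulr_ge0 ?invr_ge0 ?sqr_ge0 ?ltW.
have kaZ : 0 <= ka * Z by apply: mulr_ge0 => //; exact: ltW.
pose low a b := e a b * (Z * dl ^+ 2 / 2) - (b \in P)%:R * (deg a * (Z * ep))
  - (a == b)%:R * ((a \in P)%:R * (ka * Z)).
have lowP a b : low a b <= cost a b * M a b.
  rewrite /low /cost -/ka; case: (boolP ((a \in P) && (b \in P))) => abP; last first.
    have -> : e a b = 0.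
      rewrite /e; case: (boolP ((a, b) \in E)) => // /EP abP'.
      by rewrite abP' in abP.
    have l1 : 0 <= (b \in P)%:R * (deg a * (Z * ep)).
      by rewrite !mulr_ge0 ?ler0n // ltW.
    have l2 : 0 <= (a == b)%:R * ((a \in P)%:R * (ka * Z)).
      exact: mulr_ge0 (ler0n _ _) (mulr_ge0 (ler0n _ _) kaZ).
    by rewrite !mul0r sub0r -opprD oppr_le0 addr_ge0.
  have /andP[aP bP] := abP; rewrite aP bP !mul1r !mulrBl; apply: lerB; last first.
    by case: eqVneq => [->|_]; rewrite ?mul0r // !mul1r Maa.
  apply: lerB.
    rewrite /e; case: (boolP ((a, b) \in E)) => [abE'|_]; rewrite ?mul0r // !mul1r.
    exact: min_sqr_ge.
  case: (boolP (far a b)) => [fab|_]; last first.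
    by rewrite mul0r mul0r !mulr_ge0 // ltW.
  by rewrite mul1r ler_wpM2l // min_sqr_far.
apply: lt_le_trans (_ : \sum_a \sum_b low a b <= _); last first.
  by apply: ler_sum => a _; apply: ler_sum => b _.
have cardP : \sum_b (b \in P)%:R = #|P|%:R :> R.
  by rewrite -natr_sum -sum1_card [in RHS]big_mkcond; congr (_%:R);
    apply: eq_bigr => b _; case: ifP.
have -> : \sum_a \sum_b low a b =
    N * (Z * dl ^+ 2 / 2) - #|P|%:R * (2 * N * (Z * ep)) - #|P|%:R * (ka * Z).
  have s1 (A : R) : \sum_a \sum_b e a b * A = N * A.
    by rewrite -NE mulr_suml; apply: eq_bigr => a _; rewrite mulr_suml.
  have s2 (A : R) : \sum_a \sum_b (b \in P)%:R * (deg a * A) = #|P|%:R * (2 * N * A).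
    rewrite -degsum mulr_suml mulr_sumr; apply: eq_bigr => a _.
    by rewrite -mulr_suml cardP.
  have s3 (A : R) : \sum_a \sum_b (a == b)%:R * ((a \in P)%:R * A) = #|P|%:R * A.
    rewrite -cardP mulr_suml; apply: eq_bigr => a _.
    rewrite (bigD1 a) //= eqxx mul1r big1 ?addr0 // => b ba.
    by rewrite eq_sym (negPf ba) mul0r.
  rewrite -s1 -s2 -s3 -!sumrB; apply: eq_bigr => a _.
  by rewrite -!sumrB.
have -> : #|P|%:R * (ka * Z) = N * Z * dl ^+ 2 / 4.
  by rewrite /ka; field; rewrite gt_eqF.
have -> : N * (Z * dl ^+ 2 / 2) - #|P|%:R * (2 * N * (Z * ep)) - N * Z * dl ^+ 2 / 4 =
    N * Z / 4 * (dl ^+ 2 - 8 * #|P|%:R * ep) by field.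
by rewrite mulr_gt0 ?subr_gt0 // divr_gt0 // mulr_gt0.
Qed.

(** Some feature has a positive total cost, hence so has one of its level sets. Removing from this
    set the points with a far partner in it leaves the cluster. *)
Lemma cluster_step : E != set0 -> exists C : {set V}, [/\ C \subset P,
  forall x y, x \in C -> y \in C -> ~~ far x y,
  (0 < #|[set p in E | (p.1 \in C) && (p.2 \in C)]|)%N &
  dl ^+ 2 / 4 * N * #|C|%:R <=
    #|[set p in E | (p.1 \in C) && (p.2 \in C)]|%:R * #|P|%:R].
Proof.
move=> E0; have pos := cost_positive E0.
have [w posw] : exists w, 0 < \sum_a \sum_b cost a b * Num.min (h w a ^+ 2) (h w b ^+ 2).
  apply/existsP; apply: contraLR pos => /existsPn none; rewrite -leNgt.
  by apply: sumr_le0 => w _; rewrite leNgt.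
have [L0 posL] := level_set_positive (fun x => sqr_ge0 (h w x)) posw.
pose L := L0 :&: P; pose C := [set x in L | [forall z in L, ~~ far x z]].
have CL : C \subset L by apply/subsetP => x; rewrite inE => /andP[].
have CP : C \subset P by apply: subset_trans CL _; exact: subsetIr.
have P0 : 0 < #|P|%:R :> R.
  case/set0Pn: E0 => -[a b] /EP/andP[aP _].
  by rewrite ltr0n; apply/card_gt0P; exists a.
pose EC := [set p in E | (p.1 \in C) && (p.2 \in C)].
set ka := dl ^+ 2 / 4 * N / #|P|%:R.
have ka0 : 0 <= ka by rewrite /ka mulr_ge0 ?invr_ge0 ?ler0n // mulr_ge0 ?ler0n // divr_ge0 ?sqr_ge0.
(* An edge inside L leaves the clean part only at an end with a far point of L. *)
have main : ka * #|L|%:R < #|EC|%:R.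
  have ltL : \sum_(a in L) \sum_(b in L) ((far a b)%:R * deg a) + ka * #|L|%:R
      < \sum_(a in L) \sum_(b in L) e a b.
    have e1 : \sum_(a in L0) \sum_(b in L0) cost a b = \sum_(a in L) \sum_(b in L)
        (e a b - (far a b)%:R * deg a - (a == b)%:R * ka).
      rewrite big_mkcond [RHS]big_mkcond; apply: eq_bigr => a _; rewrite [a \in L]inE.
      case: (a \in L0) => //=; case: (boolP (a \in P)) => aP; last first.
        by apply: big1 => b _; rewrite /cost (negPf aP).
      rewrite big_mkcond [RHS]big_mkcond; apply: eq_bigr => b _; rewrite [b \in L]inE.
      by case: (b \in L0) => //=; rewrite /cost aP /=; case: (b \in P).
    have e2 : \sum_(a in L) \sum_(b in L) (a == b)%:R * ka = ka * #|L|%:R.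
      rewrite mulr_natr -sumr_const; apply: eq_bigr => a aL.
      rewrite (bigD1 a) //= eqxx mul1r big1 ?addr0 // => b /andP[_ ba].
      by rewrite eq_sym (negPf ba) mul0r.
    move: posL; rewrite e1; under eq_bigr => a _ do rewrite !sumrB.
    by rewrite !sumrB e2 => h'; rewrite -subr_gt0 opprD addrA.
  suff : \sum_(a in L) \sum_(b in L) e a b <=
      #|EC|%:R + \sum_(a in L) \sum_(b in L) ((far a b)%:R * deg a).
    by move: ltL; lra.
  pose bd a : R := \sum_(z in L) (far a z)%:R.
  have bd0 a : 0 <= bd a by apply: sumr_ge0 => *; exact: ler0n.
  have bd1 a : a \in L -> a \notin C -> 1 <= bd a.
    move=> aL; rewrite inE aL /= => /forall_inPn[z zL]; rewrite negbK => faz.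
    rewrite /bd (bigD1 z) //= faz lerDl; apply: sumr_ge0 => *; exact: ler0n.
  apply: (@le_trans _ _ (\sum_(a in L) \sum_(b in L)
      (e a b * ((a \in C) && (b \in C))%:R + e a b * bd a + e a b * bd b))).
    apply: ler_sum => a aL; apply: ler_sum => b bL; rewrite -!mulrDr.
    rewrite -{1}(mulr1 (e a b)) ler_wpM2l ?ler0n //.
    case: (boolP (a \in C)) => aC /=; last first.
      by rewrite add0r -[1]addr0 lerD // bd1.
    case: (boolP (b \in C)) => bC /=; first by rewrite -addrA lerDl addr_ge0.
    by rewrite add0r -[1]add0r lerD // bd1.
  have eC : \sum_(a in L) \sum_(b in L) e a b * ((a \in C) && (b \in C))%:R <= #|EC|%:R.
    apply: (@le_trans _ _ (\sum_a \sum_b e a b * ((a \in C) && (b \in C))%:R)).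
      apply: (@le_trans _ _ (\sum_(a in L) \sum_b e a b * ((a \in C) && (b \in C))%:R)).
        apply: ler_sum => a _; apply: ler_sum_sub => // b.
        by rewrite mulr_ge0 ?ler0n.
      apply: ler_sum_sub => // a; apply: sumr_ge0 => b _.
      by rewrite mulr_ge0 ?ler0n.
    rewrite pair_big -sum1_card natr_sum [leRHS]big_mkcond /=.
    apply: ler_sum => -[a b] _; rewrite [_ \in EC]inE /= /e.
    by case: ((a, b) \in E); rewrite /= ?mul0r // mul1r; case: (_ && _).
  have eL : \sum_(a in L) \sum_(b in L) e a b * bd a <= \sum_(a in L) bd a * \sum_b e a b.
    apply: ler_sum => a _; rewrite mulr_sumr.
    under [leRHS]eq_bigr do rewrite mulrC.
    by apply: ler_sum_sub => // b; rewrite mulr_ge0 ?ler0n.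
  have eR : \sum_(a in L) \sum_(b in L) e a b * bd b <= \sum_(a in L) bd a * \sum_b e b a.
    rewrite exchange_big /=; apply: ler_sum => a _; rewrite mulr_sumr.
    under [leRHS]eq_bigr do rewrite mulrC.
    by apply: ler_sum_sub => // b; rewrite mulr_ge0 ?ler0n.
  have -> : \sum_(a in L) \sum_(b in L) (far a b)%:R * deg a =
      \sum_(a in L) bd a * \sum_b e a b + \sum_(a in L) bd a * \sum_b e b a.
    by rewrite -big_split /=; apply: eq_bigr => a _; rewrite -mulrDr -mulr_suml.
  rewrite (eq_bigr (fun a => \sum_(b in L) e a b * ((a \in C) && (b \in C))%:R
    + \sum_(b in L) e a b * bd a + \sum_(b in L) e a b * bd b)); last first.
    by move=> a _; rewrite !big_split.
  by rewrite !big_split /= -addrA lerD // lerD.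
have nz : (0 < #|EC|)%N.
  by rewrite -(ltr0n R); apply: le_lt_trans main; rewrite mulr_ge0 ?ler0n.
exists C; split=> //.
  move=> x y; rewrite !inE => /andP[_ /forall_inP clx] /andP[yL _]; apply: clx.
  by rewrite inE.
have -> : dl ^+ 2 / 4 * N * #|C|%:R = ka * #|C|%:R * #|P|%:R.
  by rewrite /ka; field; rewrite gt_eqF.
rewrite ler_pM2r //; apply: le_trans (ltW main); rewrite ler_wpM2l // ler_nat.
exact: subset_leq_card.
Qed.
End ClusterStep.

(** A cluster costs at most [#|P| / ka] times the fraction of the remaining pairs that it covers. By
    [ln (1 - r) <= - r] these fractions add up to at most [ln #|E|], plus 1 for the last cluster,
    which covers all that is left. *)
Lemma greedy_cover (R : realType) (V : finType) (P : {set V}) (good : {set V} -> Prop)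
    (E : {set V * V}) (ka : R) : 0 < ka ->
  (forall E' : {set V * V}, E' \subset E -> E' != set0 -> exists C : {set V},
    [/\ good C, (0 < #|[set p in E' | (p.1 \in C) && (p.2 \in C)]|)%N &
     ka * #|E'|%:R * #|C|%:R <=
       #|[set p in E' | (p.1 \in C) && (p.2 \in C)]|%:R * #|P|%:R]) ->
  E != set0 -> exists Cs : seq {set V},
  [/\ forall C, C \in Cs -> good C,
      forall p, p \in E -> exists2 C, C \in Cs & (p.1 \in C) && (p.2 \in C) &
      \sum_(C <- Cs) #|C|%:R <= #|P|%:R / ka * (1 + ln #|E|%:R)].
Proof.
move=> ka0; have [n] := ubnP #|E|; elim: n E => // n IH E ltn step E0.
have [C [gC m0 ratio]] := step E (subxx _) E0.
set EC := [set p in E | (p.1 \in C) && (p.2 \in C)] in m0 ratio.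
have ECE : EC \subset E by apply/subsetP => p; rewrite inE => /andP[].
have cE : #|E|%:R = #|EC|%:R + #|E :\: EC|%:R :> R.
  by rewrite -natrD -(cardsID EC E) (setIidPr ECE).
have e0 : 0 < #|E|%:R :> R by rewrite ltr0n card_gt0.
have cC : #|C|%:R <= #|P|%:R / ka * (#|EC|%:R / #|E|%:R) :> R.
  by rewrite mulrACA -invfM ler_pdivlMr ?mulr_gt0 // mulrC [leRHS]mulrC.
have [E'0|E'0] := eqVneq (E :\: EC) set0.
  exists [:: C]; split=> [C'|p pE|]; rewrite ?inE.
  - by move=> /eqP ->.
  - exists C; rewrite ?inE //; have /subsetP/(_ p pE) : E \subset EC.
      by rewrite -setD_eq0 E'0.
    by rewrite inE => /andP[].
  - rewrite big_seq1; apply: le_trans cC _; rewrite ler_wpM2l ?divr_ge0 ?ler0n ?(ltW ka0) //.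
    have EC0 : #|EC|%:R != 0 :> R by rewrite pnatr_eq0 -lt0n.
    by rewrite cE E'0 cards0 addr0 divff // lerDl ln_ge0 // ler1n.
have E'E : E :\: EC \subset E by apply: subsetDl.
have [||Cs [gCs cov wCs]] := IH (E :\: EC) _ _ E'0.
- apply: leq_trans (_ : #|E| <= n)%N; last by rewrite -ltnS.
  by rewrite -(cardsID EC E) (setIidPr ECE) -[X in (X < _)%N]add0n ltn_add2r.
- by move=> E' E'E0; apply: step; apply: subset_trans E'E0 E'E.
exists (C :: Cs); split=> [C'|p pE|].
- by rewrite inE => /orP[/eqP ->|/gCs].
- have [pEC|pEC] := boolP (p \in EC).
    by exists C; [exact: mem_head|move: pEC; rewrite inE => /andP[]].
  have [|C' C'Cs pC'] := cov p; first by rewrite inE pEC.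
  by exists C' => //; rewrite inE C'Cs orbT.
rewrite big_cons; apply: le_trans (lerD cC wCs) _.
rewrite -mulrDr ler_wpM2l ?divr_ge0 ?ler0n ?(ltW ka0) // addrCA lerD2l.
have e'0 : 0 < #|E :\: EC|%:R :> R by rewrite ltr0n card_gt0.
have -> : #|E :\: EC|%:R = #|E|%:R * (1 + - (#|EC|%:R / #|E|%:R)) :> R.
  by rewrite cE; field; rewrite -cE gt_eqF.
have r1 : #|EC|%:R / #|E|%:R < 1 :> R by rewrite ltr_pdivrMr // mul1r cE ltrDl.
rewrite lnM ?posrE ?subr_gt0 //.
by have := @le_ln1Dx R (- (#|EC|%:R / #|E|%:R)); rewrite ltrN2 => /(_ r1); lra.
Qed.

(* Averaging (1 + al T(u x)) (1 + al T(u y)) over T = +-cos, +-sin gives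
   1 + al^2 / 2 * cos (u x - u y); the choice of al makes this proportional to
   1 - w (1 - cos (u x - u y)). *)
Section Features.
Variables (R : realType) (V J : finType) (u : J -> V -> R) (w : J -> R).
Hypothesis wP : forall j, 0 <= w j <= 1 / 3.

Let al j := Num.sqrt (2 * w j / (1 - w j)).
Let tr (q : bool * bool) (s : R) := (-1) ^+ q.1 * (if q.2 then cos s else sin s).
Let F j q x := 1 + al j * tr q (u j x).

Lemma trig_features : exists (Om : finType) (h : Om -> V -> R) (Z : R),
  [/\ 0 < Z, forall o x, 0 <= h o x &
    forall x y, \sum_o h o x * h o y =
      Z * \prod_j (1 - w j * (1 - cos (u j x - u j y)))].
Proof.
have w1 j : 0 < 1 - w j by have := wP j; lra.
have al2 j : al j ^+ 2 = 2 * w j / (1 - w j).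
  by rewrite sqr_sqrtr // divr_ge0 ?mulr_ge0 ?(ltW (w1 j)) //; have /andP[] := wP j.
(* The bound [w j <= 1 / 3] amounts to [2 * w j <= 1 - w j]; then [al j <= 1] makes the features
   nonnegative. *)
have al01 j : 0 <= al j <= 1.
  rewrite sqrtr_ge0 /= -(expr_le1 (n := 2)) ?sqrtr_ge0 // al2.
  by rewrite ler_pdivrMr //; have := wP j; lra.
have tr1 q s : `|tr q s| <= 1.
  rewrite /tr normrM normrX normrN1 expr1n mul1r.
  by case: q.2; [exact: cos_max|exact: sin_max].
exists {ffun J -> bool * bool},
  (fun (o : {ffun J -> bool * bool}) x => \prod_j F j (o j) x),
  (\prod_j (4 / (1 - w j))); split.
- by apply: prodr_gt0 => j _; rewrite divr_gt0.
- move=> o x; apply: prodr_ge0 => j _; rewrite /F.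
  have /andP[a0 a1] := al01 j; have := tr1 (o j) (u j x); rewrite ler_norml => /andP[t0 _].
  by have := ler_wpM2l a0 t0; lra.
move=> x y; rewrite -big_split /=.
under eq_bigr => o _ do rewrite -big_split /=.
rewrite -(bigA_distr_bigA (fun j q => F j q x * F j q y)).
apply: eq_bigr => j _; rewrite -(pair_bigA _ (fun a b => F j (a, b) x * F j (a, b) y)) /=.
rewrite !big_bool /= /F /tr /= cosB.
set cx := cos (u j x); set cy := cos (u j y); set sx := sin _; set sy := sin _.
(* Over the four trigonometric functions the linear terms cancel; the choice of [al j] turns the
   rest into [4 / (1 - w j)] times the factor of index [j]. *)
transitivity (4 + 2 * al j ^+ 2 * (cx * cy + sx * sy)); first by ring.
by rewrite al2; field; rewrite gt_eqF.
Qed.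
End Features.

Lemma prod_exp_bounds (R : realType) (J : finType) (v : J -> R) :
  (forall j, 0 <= v j <= 1 / 2) ->
  expR (- (2 * \sum_j v j)) <= \prod_j (1 - v j) <= expR (- \sum_j v j).
Proof.
move=> vP; rewrite mulr_sumr -!sumrN !expR_sum; apply/andP; split.
  apply: ler_prod => j _; rewrite expR_ge0 /=.
  rewrite expRN -[leLHS]mul1r ler_pdivrMr ?expR_gt0 //.
  have := expR_ge1Dx (2 * v j); have := vP j; move: (expR _) => e h1 h2.
  have : (1 - v j) * (1 + 2 * v j) <= (1 - v j) * e by rewrite ler_wpM2l //; lra.
  by apply: le_trans; nra.
apply: ler_prod => j _; have := expR_ge1Dx (- v j); have := vP j.
by move=> *; apply/andP; split; lra.
Qed.

(** * Multiscale approximation of powers *)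

Section Versine.
Variable R : realType.
Implicit Types s : R.

Definition versine s := 1 - cos s.

Lemma versine_norm s : versine `|s| = versine s.
Proof. by rewrite /versine cos_norm. Qed.

Lemma versine_double s : versine (2 * s) = 2 * sin s ^+ 2.
Proof. by rewrite /versine mulr_natl cos_mulr2n cos2sin2; ring. Qed.

Lemma versine_ge0 s : 0 <= versine s.
Proof. by rewrite subr_ge0 cos_le1. Qed.

Lemma versine_le2 s : versine s <= 2.
Proof. by rewrite /versine; have := cos_geN1 s; lra. Qed.

Lemma sin_norm_le s : `|sin s| <= `|s|.
Proof.
wlog s0 : s / 0 <= s.
  move=> H; have [s0|/ltW s0] := leP 0 s; first exact: H.
  by have := H (- s); rewrite oppr_ge0 sinN !normrN; exact.
have dsin (x : R) : x \in `]0, s[ -> is_derive x 1 sin (cos x) by move=> _; exact: is_derive_sin.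
have csin : {within `[0, s], continuous (@sin R)}%classic.
  by apply: continuous_subspaceT => x; exact: continuous_sin.
have [c _] := MVT_segment s0 dsin csin.
rewrite sin0 !subr0 => ->.
by rewrite normrM ler_piMl // cos_max.
Qed.

Lemma versine_le_sqr s : versine s <= s ^+ 2 / 2.
Proof.
have -> : versine s = versine (2 * (s / 2)) by congr versine; field.
rewrite versine_double; have := sin_norm_le (s / 2).
rewrite -(ler_pXn2r (n := 2)) ?nnegrE // !real_normK ?num_real // => h.
have -> : s ^+ 2 / 2 = 2 * (s / 2) ^+ 2 by field.
by rewrite ler_pM2l.
Qed.

Lemma versine_double_le s : versine (2 * s) <= 4 * versine s.
Proof.
rewrite versine_double sin2cos2 /versine.
have -> : 2 * (1 - cos s ^+ 2) = 2 * (1 - cos s) * (1 + cos s) by ring.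
have := cos_le1 s; have := cos_geN1 s; nra.
Qed.

Lemma versine1_gt0 : 0 < versine 1.
Proof.
have p2 := pi_ge2 R; rewrite subr_gt0 -[ltRHS]cos0 ltr_cos ?ltr01 // in_itv /=.
  by apply/andP; split; lra.
by apply/andP; split; lra.
Qed.

Lemma versine_ge1 s : 1 <= s <= 2 -> versine 1 <= versine s.
Proof.
move=> /andP[s1 s2]; have p2 := pi_ge2 R.
move: s1; rewrite le_eqVlt => /orP[/eqP <- //|s1].
rewrite lerD2l lerN2 ltW // ltr_cos // in_itv /=; apply/andP; split; lra.
Qed.

(** Read from left to right, it carries a lower bound at a large scale down to all smaller ones. *)
Lemma versine_descend s k : versine (2 ^+ k * s) <= 4 ^+ k * versine s.
Proof.
elim: k => [|k IH]; first by rewrite !expr0 !mul1r.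
rewrite !exprS -!mulrA; apply: le_trans (versine_double_le _) _.
by rewrite ler_pM2l.
Qed.

End Versine.

Lemma geometric_sum_rev (R : comRingType) (q rho : R) n : q * rho = 1 ->
  \sum_(k < n.+1) q ^+ k = q ^+ n * \sum_(k < n.+1) rho ^+ k.
Proof.
move=> qr; elim: n => [|n IH]; first by rewrite !big_ord1 !expr0 mulr1.
rewrite big_ord_recr /= IH [in RHS]big_ord_recl expr0 mulrDr mulr1 addrC.
congr (_ + _); rewrite exprSr -mulrA; congr (_ * _).
rewrite mulr_sumr; apply: eq_bigr => i _.
by rewrite exprS mulrA qr mul1r.
Qed.

Section Multiscale.
Variables (R : realType) (p : R).
Hypotheses (p1 : 1 <= p) (p2 : p <= 2).

(** [b ^+ k] is the weight of the frequency [2 ^+ k]. Since [4 * b] is the inverse of [rho], the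
    quadratic contributions up to scale [k] add up to [G k] times the last one. [G] is bounded for
    [p < 2] and grows linearly at [p = 2]. *)
Let b : R := 2 `^ (- p).
Let rho : R := 2 `^ (p - 2).
Let G n : R := \sum_(k < n.+1) rho ^+ k.

Let b0 : 0 < b. Proof. by rewrite powR_gt0. Qed.
Let rho0 : 0 < rho. Proof. by rewrite powR_gt0. Qed.

Let rho1 : rho <= 1.
Proof. by rewrite -[leRHS](powRr0 (2 : R)) ler_powR ?ler1n //; move: p2; lra. Qed.

Let b_half : b <= 1 / 2.
Proof.
rewrite div1r -(powR_inv1 (ler0n R 2)) ler_powR ?ler1n //; move: p1; lra.
Qed.

Let b4rho : (4 * b) * rho = 1.
Proof.
have -> : (4 : R) = 2 `^ 2%:R by rewrite powR_mulrn // expr2 -natrM.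
rewrite -!powRD ?pnatr_eq0 ?implybT //.
have -> : 2%:R + - p + (p - 2) = 0 by ring.
exact: powRr0.
Qed.

Let G_ge1 n : 1 <= G n.
Proof.
rewrite /G big_ord_recl expr0 lerDl; apply: sumr_ge0 => i _.
by rewrite exprn_ge0 // ltW.
Qed.

Let G_mono m n : (m <= n)%N -> G m <= G n.
Proof.
move=> mn; rewrite /G (big_ord_widen n.+1 (fun k => rho ^+ k)) // [leLHS]big_mkcond /=.
by apply: ler_sum => i _; case: ifP => // _; rewrite exprn_ge0 // ltW.
Qed.

(** The powers of [rho <= 1] decrease, so the second half of the sum is no larger than the first.
    This makes the comparison uniform up to [p = 2]. *)
Let G_double A n : (n <= A + A)%N -> G n <= 2 * G A.
Proof.
move=> nA; apply: le_trans (G_mono (n := A.+1 + A) _) _; first by lia.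
rewrite /G -addnS big_split_ord /= mulrDl !mul1r lerD2l.
apply: ler_sum => i _; rewrite exprD ler_piMl ?exprn_ge0 ?(ltW rho0) //.
by rewrite exprn_ile1 // ltW.
Qed.

(** Let [k] be least with [2 ^+ k * v >= 1]; the range of [v] puts it between [A] and [A + A], and
    the power of [v] is comparable to [b ^+ k]. Up to [k] the versine is quadratic and contributes
    about [b ^+ k * G k]; beyond [k] it is at most 2 against geometric weights. *)
Lemma multiscale_value A v : 2 ^- (A + A) <= v -> v <= 2 ^- A ->
  versine 1 / 4 * (G A * v `^ p) <=
    \sum_(k < (A + A).+1) b ^+ k * versine (2 ^+ k * v) <= 8 * (G A * v `^ p).
Proof.
have [p1' p2'] := (p1, p2); move=> vlo vhi.
have v0 : 0 < v by apply: lt_le_trans vlo; rewrite invr_gt0 exprn_gt0.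
have c0 := versine1_gt0 R; have bb := b0; have b2 := b_half.
have exk : exists k, 1 <= 2 ^+ k * v.
  by exists (A + A)%N; rewrite -ler_pdivrMl ?mulr1 // exprn_gt0.
have [k k1 kmin] := ex_minnP exk.
have kA : (k <= A + A)%N by apply: kmin; rewrite -ler_pdivrMl ?mulr1 // exprn_gt0.
have Ak : (A <= k)%N.
  rewrite -(ler_eXn2l (x := 2 : R)) ?ltr1n //.
  have : 2 ^+ k * v <= 2 ^+ k / 2 ^+ A by rewrite ler_pM2l // exprn_gt0.
  by move/(le_trans k1); rewrite ler_pdivlMr ?exprn_gt0 // mul1r.
have k2 : 2 ^+ k * v <= 2.
  case: k k1 kmin {kA Ak} => [|k] k1 kmin.
    rewrite expr0 mul1r; apply: le_trans vhi _; apply: le_trans (_ : 1 <= _).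
      by rewrite invf_le1 ?exprn_ege1 ?exprn_gt0 ?ler1n.
    by rewrite ler1n.
  rewrite exprS -mulrA -[leRHS]mulr1 ler_pM2l // leNgt; apply/negP => /ltW /kmin.
  by rewrite ltnn.
have vp : b ^+ k <= v `^ p <= 4 * b ^+ k.
  have bk : b ^+ k = (2 ^+ k) `^ (- p).
    rewrite -(powR_mulrn k (powR_ge0 _ _)) -(powR_mulrn k (ler0n _ 2)).
    by rewrite -!powRrM mulNr mulrN mulrC.
  have -> : v `^ p = (2 ^+ k * v) `^ p * b ^+ k.
    rewrite bk powRM ?exprn_ge0 ?(ltW v0) // mulrAC -powRD; last first.
      by rewrite expf_eq0 pnatr_eq0 andbF implybT.
    by rewrite subrr powRr0 mul1r.
  have bk0 : 0 < b ^+ k by rewrite exprn_gt0.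
  apply/andP; split.
    rewrite ler_peMl ?(ltW bk0) //.
    have : 1 `^ p <= (2 ^+ k * v) `^ p.
      by rewrite ge0_ler_powR ?nnegrE ?(le_trans _ k1) //; lra.
    by rewrite powR1.
  rewrite ler_pM2r //; apply: le_trans (_ : 2 `^ p <= _).
    rewrite ge0_ler_powR ?nnegrE //; first by lra.
    by apply: le_trans k1.
  have -> : (4 : R) = 2 `^ 2%:R by rewrite powR_mulrn // expr2 -natrM.
  by rewrite ler_powR ?ler1n //; lra.
have [bv vb] := andP vp.
have Gk : G A <= G k <= 2 * G A by rewrite G_mono // G_double.
have [Gk1 Gk2] := andP Gk; have G1 := G_ge1 A; have G1k := G_ge1 k.
have bk0 : 0 < b ^+ k by rewrite exprn_gt0.
(* the scales up to k carry the weight (4 b)^i, which sums to (4 b)^k G k *)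
have low4 : \sum_(i < k.+1) b ^+ i * 4 ^+ i = b ^+ k * 4 ^+ k * G k.
  rewrite (eq_bigr (fun i : 'I_k.+1 => (4 * b) ^+ i)); last first.
    by move=> i _; rewrite exprMn mulrC.
  by rewrite (geometric_sum_rev k b4rho) exprMn [4 ^+ k * _]mulrC.
have four i : (4 : R) ^+ i = (2 ^+ i) ^+ 2 by rewrite exprAC expr2 -natrM.
apply/andP; split.
  apply: (@le_trans _ _ (\sum_(i < k.+1) b ^+ i * versine (2 ^+ i * v))); last first.
    rewrite (big_ord_widen (A + A).+1 (fun i => b ^+ i * versine (2 ^+ i * v))) //.
    rewrite big_mkcond /=; apply: ler_sum => i _; case: ifP => // _.
    by rewrite mulr_ge0 ?versine_ge0 // exprn_ge0 // ltW.
  apply: (@le_trans _ _ (\sum_(i < k.+1) b ^+ i * 4 ^+ i * (versine 1 / 4 ^+ k))).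
    rewrite -mulr_suml low4.
    have -> : b ^+ k * 4 ^+ k * G k * (versine 1 / 4 ^+ k) = versine 1 * (G k * b ^+ k).
      by field; rewrite expf_neq0 // pnatr_eq0.
    rewrite -mulrA ler_pM2l // ler_pdivrMl //.
    have : G A * v `^ p <= G k * (4 * b ^+ k).
      by rewrite ler_pM ?powR_ge0 //; lra.
    by move/le_trans; apply; rewrite le_eqVlt; apply/orP; left; apply/eqP; ring.
  apply: ler_sum => i _; rewrite -mulrA ler_pM2l ?exprn_gt0 //.
  have ik : (i <= k)%N by rewrite -ltnS.
  have := versine_descend (2 ^+ i * v) (k - i).
  rewrite mulrA -exprD subnK // => h.
  have c1 : versine 1 <= versine (2 ^+ k * v) by rewrite versine_ge1 // k1.
  rewrite mulrA ler_pdivrMr ?exprn_gt0 //.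
  apply: le_trans (_ : 4 ^+ i * (4 ^+ (k - i) * versine (2 ^+ i * v)) <= _).
    by rewrite ler_pM2l ?exprn_gt0 // (le_trans c1).
  by rewrite mulrA -exprD subnKC // mulrC.
pose S := \sum_(i < k.+1) b ^+ i * versine (2 ^+ i * v).
have tail n : \sum_(i < n + k.+1) b ^+ i * versine (2 ^+ i * v) + 2 * b ^+ (n + k) <=
    S + 2 * b ^+ k.
  elim: n => [|n IH]; first by rewrite !add0n.
  apply: le_trans IH; rewrite !addSn big_ord_recr /= -addrA lerD2l.
  rewrite addnS exprS; have bn : 0 < b ^+ (n + k) by rewrite exprn_gt0.
  have : b * b ^+ (n + k) * versine (2 ^+ (n + k).+1 * v) <= b * b ^+ (n + k) * 2.
    by rewrite ler_wpM2l ?versine_le2 // mulr_ge0 // ltW.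
  have : b * b ^+ (n + k) <= 1 / 2 * b ^+ (n + k) by rewrite ler_pM2r.
  lra.
have total : \sum_(i < (A + A).+1) b ^+ i * versine (2 ^+ i * v) <= S + 2 * b ^+ k.
  have := tail (A + A - k)%N; rewrite addnS subnK //.
  have : 0 < b ^+ (A + A) by rewrite exprn_gt0.
  lra.
have SG : S <= 2 * (b ^+ k * G k).
  apply: (@le_trans _ _ (\sum_(i < k.+1) b ^+ i * 4 ^+ i * (v ^+ 2 / 2))).
    apply: ler_sum => i _; rewrite -mulrA ler_pM2l ?exprn_gt0 //.
    by apply: le_trans (versine_le_sqr _) _; rewrite exprMn four -mulrA.
  rewrite -mulr_suml low4.
  have -> : b ^+ k * 4 ^+ k * G k * (v ^+ 2 / 2) = b ^+ k * G k * ((2 ^+ k * v) ^+ 2 / 2).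
    by rewrite exprMn four; ring.
  rewrite [leRHS]mulrC ler_pM2l ?mulr_gt0 //; last by lra.
  by move: k1 k2; nra.
apply: le_trans total _.
have : b ^+ k * 1 <= b ^+ k * G k by rewrite ler_pM2l.
have : b ^+ k * G k <= b ^+ k * (2 * G A) by rewrite ler_pM2l.
have : G A * b ^+ k <= G A * v `^ p by rewrite ler_pM2l //; lra.
by move: SG; lra.
Qed.
End Multiscale.

Lemma multiscale (R : realType) (p : R) (I : finType) (u : I -> R) :
  1 <= p -> p <= 2 -> exists (K : nat) (la c : nat -> R),
  (forall k, 0 <= c k) /\
  forall i, versine 1 / 4 * `|u i| `^ p <=
    \sum_(k < K) c k * versine (la k * u i) <= 8 * `|u i| `^ p.
Proof.
move=> p1 p2; pose M := 1 + \sum_i `|u i|; pose m := 1 + \sum_i `|u i|^-1.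
have M0 : 0 < M by rewrite ltr_wpDr // sumr_ge0.
have m0 : 0 < m by rewrite ltr_wpDr // sumr_ge0 // => i _; rewrite invr_ge0.
have uM i : `|u i| <= M.
  by rewrite /M (bigD1 i) //= addrCA lerDl addr_ge0 // sumr_ge0.
have um i : u i != 0 -> m^-1 <= `|u i|.
  move=> ui; rewrite -[leRHS]invrK lef_pV2 ?posrE ?invr_gt0 ?normr_gt0 //.
  by rewrite /m (bigD1 i) //= addrCA lerDl addr_ge0 // sumr_ge0.
have [A TA] : exists A : nat, M * m <= 2 ^+ A.
  exists (Num.bound (M * m)); apply: le_trans (ltW (archi_boundP _)) _.
    by rewrite mulr_ge0 // ltW.
  by rewrite -natrX ler_nat ltnW // ltn_expl.
(* All nonzero values [|u i|] lie between the inverse of [m] and [M]; as [M * m <= 2 ^+ A], this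
   factor moves them into the range of [multiscale_value]. *)
pose sg := 2 ^- A / M.
have sg0 : 0 < sg by rewrite divr_gt0 // invr_gt0 exprn_gt0.
have [G [G0 ms]] : exists G, 0 < G /\ forall v, 2 ^- (A + A) <= v -> v <= 2 ^- A ->
    versine 1 / 4 * (G * v `^ p) <=
    \sum_(k < (A + A).+1) (2 `^ (- p)) ^+ k * versine (2 ^+ k * v) <=
    8 * (G * v `^ p).
  exists (\sum_(k < A.+1) (2 `^ (p - 2)) ^+ k); split; last exact: multiscale_value.
  by rewrite big_ord_recl expr0 ltr_wpDr // sumr_ge0.
have Gs : 0 < G * sg `^ p by rewrite mulr_gt0 // powR_gt0.
exists (A + A).+1, (fun k => sg * 2 ^+ k), (fun k => (2 `^ (- p)) ^+ k / (G * sg `^ p)).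
split=> [k|i]; first by rewrite divr_ge0 ?exprn_ge0 ?powR_ge0 // ltW.
have [->|ui] := eqVneq (u i) 0.
  rewrite normr0 powR0 ?gt_eqF // ?mulr0; last by lra.
  by rewrite big1 ?lexx // => k _; rewrite mulr0 /versine cos0 subrr mulr0.
pose v := sg * `|u i|; have ui0 : 0 < `|u i| by rewrite normr_gt0.
have vlo : 2 ^- (A + A) <= v.
  rewrite exprD invfM /v /sg -mulrA ler_pM2l ?invr_gt0 ?exprn_gt0 //.
  apply: le_trans (_ : M^-1 * m^-1 <= _); last by rewrite ler_pM2l ?invr_gt0 ?um.
  by rewrite -invfM lef_pV2 ?posrE ?exprn_gt0 ?mulr_gt0.
have vhi : v <= 2 ^- A.
  by rewrite /v /sg -mulrA ger_pMr ?invr_gt0 ?exprn_gt0 // ler_pdivrMl // mulr1.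
have := ms v vlo vhi.
have -> : v `^ p = sg `^ p * `|u i| `^ p by rewrite powRM // ltW.
have -> : \sum_(k < (A + A).+1) (2 `^ (- p)) ^+ k / (G * sg `^ p) *
    versine (sg * 2 ^+ k * u i) =
    (\sum_(k < (A + A).+1) (2 `^ (- p)) ^+ k * versine (2 ^+ k * v)) / (G * sg `^ p).
  rewrite mulr_suml; apply: eq_bigr => k _; rewrite mulrAC; congr (_ * _ / _).
  rewrite -versine_norm -[in RHS]versine_norm /v; congr versine.
  by rewrite !normrM normr_id; ring.
by rewrite ler_pdivrMr // ler_pdivlMr // !mulrA ![_ * _ * `|u i| `^ p]mulrAC
  => /andP[-> ->].
Qed.

(** * Clusters and distances in the p-norms *)

Definition lp_sum (R : realType) (p : R) (D : nat) (x : 'rV[R]_D) : R :=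
  \sum_(i < D) `|x 0 i| `^ p.

Lemma lp_sum_ge0 (R : realType) (p : R) D (x : 'rV[R]_D) : 0 <= lp_sum p x.
Proof. by apply: sumr_ge0 => i _; exact: powR_ge0. Qed.

Lemma lp_norm_ge0 (R : realType) (p : R) D (x : 'rV[R]_D) : 0 <= lp_norm p x.
Proof. exact: powR_ge0. Qed.

Lemma lp_norm_powR (R : realType) (p : R) D (x : 'rV[R]_D) : 0 < p ->
  lp_norm p x `^ p = lp_sum p x.
Proof. by move=> p0; rewrite -powRrM mulVf ?gt_eqF // powRr1 // lp_sum_ge0. Qed.

Lemma lp_norm_le (R : realType) (p r : R) D (x : 'rV[R]_D) : 0 < p -> 0 <= r ->
  (lp_norm p x <= r) = (lp_sum p x <= r `^ p).
Proof.
move=> p0 r0; rewrite -lp_norm_powR //; apply/idP/idP => [|].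
  by apply: ge0_ler_powR; rewrite ?nnegrE ?lp_norm_ge0 // ltW.
by apply: contraTT; rewrite -!ltNge; apply: gt0_ltr_powR; rewrite ?nnegrE ?lp_norm_ge0.
Qed.

Lemma lp_features (R : realType) (p s : R) (V : finType) D (pt : V -> 'rV[R]_D) :
  1 <= p -> p <= 2 -> 0 <= s ->
  exists (Om : finType) (h : Om -> V -> R) (k : V -> V -> R) (Z : R),
  [/\ 0 < Z, forall o x, 0 <= h o x,
      forall x y, \sum_o h o x * h o y = Z * k x y, forall x, k x x = 1 &
      forall x y, expR (- (16 * s * lp_sum p (pt x - pt y))) <= k x y <=
        expR (- (versine 1 / 4 * s * lp_sum p (pt x - pt y)))].
Proof.
move=> p1 p2 s0.
have [K [la [c [c0 ms]]]] := multiscale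
  (fun q : V * V * 'I_D => pt q.1.1 0 q.2 - pt q.1.2 0 q.2) p1 p2.
(* Each weight [s * c k] is split into [B] equal copies, which brings it down to 1/4: small enough
   for the features and for comparing the product with an exponential. *)
pose B := (Num.bound (4 * s * \sum_(k < K) c k)).+1.
have sc0 : 0 <= 4 * s * \sum_(k < K) c k.
  by rewrite !mulr_ge0 // sumr_ge0.
have B0 : 0 < B%:R :> R by rewrite ltr0n.
have sB k : (k < K)%N -> s * c k / B%:R <= 1 / 4.
  move=> kK; rewrite ler_pdivrMr //.
  suff : 4 * s * c k <= B%:R by lra.
  apply: le_trans (_ : 4 * s * \sum_(k < K) c k <= _).
    rewrite ler_wpM2l ?mulr_ge0 // (bigD1 (Ordinal kK)) //= lerDl.
    exact: sumr_ge0.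
  by apply: le_trans (ltW (archi_boundP sc0)) _; rewrite ler_nat.
pose w (j : 'I_D * 'I_K * 'I_B) := s * c j.1.2 / B%:R.
have w0 j : 0 <= w j <= 1 / 4.
  by rewrite sB // andbT divr_ge0 ?ler0n // mulr_ge0.
have [|Om [h [Z [Z0 h0 hZ]]]] := @trig_features R V _
  (fun (j : 'I_D * 'I_K * 'I_B) x => la j.1.2 * pt x 0 j.1.1) w.
  by move=> j; have /andP[-> h] := w0 j; lra.
exists Om, h, (fun x y => \prod_j (1 - w j * versine
  (la j.1.2 * pt x 0 j.1.1 - la j.1.2 * pt y 0 j.1.1))), Z; split=> // [x|x y].
  by apply: big1 => j _; rewrite subrr /versine cos0 subrr mulr0 subr0.
pose v (j : 'I_D * 'I_K * 'I_B) := w j * versine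
  (la j.1.2 * pt x 0 j.1.1 - la j.1.2 * pt y 0 j.1.1).
have vP j : 0 <= v j <= 1 / 2.
  have /andP[wj0 wj1] := w0 j; rewrite /v.
  move: (_ - _) => a; have := versine_le2 a; have := versine_ge0 a.
  by move=> *; apply/andP; split; nra.
have vE : \sum_j v j = s * \sum_(i < D) \sum_(k < K)
    c k * versine (la k * (pt x 0 i - pt y 0 i)).
  rewrite -(pair_bigA _ (fun j (b : 'I_B) => v (j, b))) /=.
  rewrite -(pair_bigA _ (fun i k => \sum_(b < B) v ((i, k), b))) /=.
  rewrite mulr_sumr; apply: eq_bigr => i _; rewrite mulr_sumr; apply: eq_bigr => k _.
  rewrite /v /w /= sumr_const card_ord -mulrBr -mulrnAl -mulr_natr.
  by rewrite mulfVK ?gt_eqF // mulrA.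
have /andP[l1 l2] := prod_exp_bounds vP; rewrite vE in l1 l2.
have lpE : lp_sum p (pt x - pt y) = \sum_(i < D) `|pt x 0 i - pt y 0 i| `^ p.
  by apply: eq_bigr => i _; rewrite !mxE.
rewrite lpE; apply/andP; split.
  apply: le_trans l1; rewrite ler_expR lerN2.
  have : \sum_(i < D) \sum_(k < K) c k * versine (la k * (pt x 0 i - pt y 0 i)) <=
      8 * \sum_(i < D) `|pt x 0 i - pt y 0 i| `^ p.
    by rewrite mulr_sumr; apply: ler_sum => i _; have /andP[] := ms (x, y, i).
  by move/(ler_wpM2l s0); lra.
apply: le_trans l2 _; rewrite ler_expR lerN2.
have : versine 1 / 4 * \sum_(i < D) `|pt x 0 i - pt y 0 i| `^ p <=
  \sum_(i < D) \sum_(k < K) c k * versine (la k * (pt x 0 i - pt y 0 i)).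
  by rewrite mulr_sumr; apply: ler_sum => i _; have /andP[] := ms (x, y, i).
by move/(ler_wpM2l s0); rewrite mulrA [s * (_ / _)]mulrC.
Qed.

Lemma lp_clusters (R : realType) : exists2 Cc : R, 1 <= Cc &
  forall (p t r : R) (n D : nat) (V : finType) (pt : V -> 'rV[R]_D) (P : {set V}),
  1 < p -> p <= 2 -> 2 <= t -> 0 < r -> (2 <= n)%N -> (#|P| <= n)%N ->
  exists Cs : seq {set V},
  [/\ forall C, C \in Cs -> C \subset P /\
        forall x y, x \in C -> y \in C -> lp_norm p (pt x - pt y) <= Cc * t * r,
      forall x y, x \in P -> y \in P -> lp_norm p (pt x - pt y) <= r ->
        exists2 C, C \in Cs & (x \in C) && (y \in C) &
      \sum_(C <- Cs) #|C|%:R <=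
        #|P|%:R * (4 * n%:R `^ (ln t ^+ 2 / t `^ p)) * (1 + 2 * ln n%:R)].
Proof.
have c0 := versine1_gt0 R; have ln2 : 0 < ln 2 :> R by rewrite ln_gt0 // ltr1n.
pose q : R := 4 * 16 * 7 / (versine 1 / 4).
have q0 : 0 < q by rewrite !(mulr_gt0, divr_gt0, invr_gt0) // ltr0n.
(* The summand [q] gives [q <= 2 * T], which keeps [dl ^+ 2] above [1 / n]. The last summand gives
   [q <= Cc * ln t ^+ 2], which bounds the exponent of [n]. *)
pose Cc := 1 + q + q / ln 2 ^+ 2.
have qln : 0 < q / ln 2 ^+ 2 by rewrite divr_gt0 // exprn_gt0.
have Cc1 : 1 <= Cc by rewrite /Cc; lra.
exists Cc => // p t r n D V pt P p1 p2 t2 r0 n2 Pn.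
have p0 : 0 < p by lra.
have t0 : 0 < t by lra.
have n0 : 0 < n%:R :> R by rewrite ltr0n (leq_trans _ n2).
have n2R : 2 <= n%:R :> R by rewrite ler_nat.
have lnn : 0 < ln n%:R :> R by rewrite ln_gt0 // ltr1n.
pose T := Cc * t; have T0 : 0 < T by rewrite mulr_gt0 //; lra.
have T1 : 1 <= T by rewrite /T; nra.
pose E := [set z : V * V | [&& z.1 \in P, z.2 \in P & lp_norm p (pt z.1 - pt z.2) <= r]].
have RHS0 : 0 <= #|P|%:R * (4 * n%:R `^ (ln t ^+ 2 / t `^ p)) * (1 + 2 * ln n%:R).
  by rewrite !mulr_ge0 ?powR_ge0 ?ler0n // addr_ge0 // mulr_ge0 // ltW.
have [E0|E0] := eqVneq E set0.
  exists [::]; split=> //; last by rewrite big_nil.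
  move=> x y xP yP le; have : (x, y) \in E by rewrite inE /= xP yP.
  by rewrite E0 inE.
have Tr0 : 0 < T * r by rewrite mulr_gt0.
(* Chosen so that the upper bound of the kernel at distance [T * r] is [n ^- 7]; the lower bound at
   distance [r] is then [expR (- x)] with the [x] below. *)
pose s := 7 * ln n%:R / (versine 1 / 4 * (T * r) `^ p).
have Trp : 0 < (T * r) `^ p by rewrite powR_gt0.
have s0 : 0 < s by rewrite !(mulr_gt0, divr_gt0, invr_gt0).
have [Om [h [k [Z [Z0 h0 hk kxx kb]]]]] := lp_features pt (ltW p1) p2 (ltW s0).
pose far x y := T * r < lp_norm p (pt x - pt y).
pose x := q * ln n%:R / (4 * T `^ p).
have Tp : 0 < T `^ p by rewrite powR_gt0.
pose dl : R := expR (- x); pose ep : R := expR (- (7 * ln n%:R)).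
have dl0 : 0 < dl by exact: expR_gt0.
have kE z : z \in E -> dl <= k z.1 z.2.
  rewrite inE lp_norm_le // ?(ltW r0) // => /and3P[_ _ le].
  have /andP[lo _] := kb z.1 z.2; apply: le_trans lo; rewrite ler_expR lerN2.
  apply: le_trans (_ : 16 * s * r `^ p <= _).
    by rewrite ler_pM2l // mulr_gt0.
  rewrite /s /x /q powRM ?(ltW T0) ?(ltW r0) // le_eqVlt; apply/orP; left; apply/eqP.
  by field; rewrite !gt_eqF // powR_gt0.
have kfar a b : far a b -> k a b <= ep.
  rewrite /far ltNge lp_norm_le ?(ltW Tr0) // -ltNge => lt.
  have /andP[_ hi] := kb a b; apply: le_trans hi _; rewrite ler_expR lerN2.
  apply: le_trans (_ : versine 1 / 4 * s * (T * r) `^ p <= _).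
    rewrite /s le_eqVlt; apply/orP; left; apply/eqP.
    by field; rewrite !gt_eqF.
  by rewrite ler_pM2l ?(ltW lt) // mulr_gt0 // divr_gt0.
have T_le : T <= T `^ p by rewrite le1r_powR // ltW.
have q_le : q <= 2 * T by rewrite /T /Cc; nra.
have x_le : 2 * x <= ln n%:R.
  rewrite /x mulrA ler_pdivrMr ?mulr_gt0 // mulrA [leRHS]mulrC ler_pM2r //.
  by lra.
have x_ge0 : 0 <= x by rewrite ltW // divr_gt0 // mulr_gt0.
have epE : ep = n%:R ^- 7.
  by rewrite /ep expRN expRM_natl lnK ?posrE.
have dl2 : dl ^+ 2 = expR (- (2 * x)) by rewrite /dl -expRM_natl mulrN.
(* With [dl ^+ 2 >= 1 / n] and [#|P| <= n] this comes down to [8 < n ^+ 5], true from [n = 2] on. *)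
have ep_dl : 8 * #|P|%:R * ep < dl ^+ 2.
  apply: lt_le_trans (_ : n%:R^-1 <= _); last first.
    by rewrite dl2 -[n%:R in leLHS]lnK ?posrE // -expRN ler_expR lerN2.
  rewrite epE ltr_pdivrMr ?exprn_gt0 // exprS mulKf ?gt_eqF //.
  apply: (@le_lt_trans _ _ (8 * n%:R)); first by rewrite ler_pM2l // ler_nat.
  rewrite exprSr ltr_pM2r //; apply: (@lt_le_trans _ _ (2 ^+ 5)).
    by rewrite -natrX ltr_nat.
  by rewrite lerXn2r // nnegrE ltW.
have [||Cs [gCs cov wCs]] := @greedy_cover R V P
  (fun C => C \subset P /\ forall a b, a \in C -> b \in C -> ~~ far a b) E (dl ^+ 2 / 4) _ _ E0.
- by rewrite divr_gt0 // exprn_gt0.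
- move=> E' E'E E'0.
  have E'P a b : (a, b) \in E' -> (a \in P) && (b \in P).
    by move/(subsetP E'E); rewrite inE => /and3P[-> ->].
  have [C [CP nf pos ratio]] := @cluster_step R V Om P E' far h k Z dl ep E'P h0 Z0 dl0 hk kxx
    (fun a b ab => kE (a, b) (subsetP E'E _ ab)) kfar (expR_ge0 _) ep_dl E'0.
  by exists C.
exists Cs; split.
- move=> C /gCs[CP nf]; split=> // a b aC bC.
  by have := nf a b aC bC; rewrite /far -leNgt.
- move=> a b aP bP le; have [|C CCs abC] := cov (a, b); first by rewrite inE /= aP bP.
  by exists C.
apply: le_trans wCs _.
have cardE : #|E|%:R <= n%:R ^+ 2 :> R.
  rewrite -natrX ler_nat; apply: leq_trans (_ : #|setX P P| <= _)%N.
    by apply: subset_leq_card; apply/subsetP => z; rewrite !inE => /and3P[-> ->].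
  by rewrite cardsX expnS expn1 leq_mul.
have cardE0 : 0 < #|E|%:R :> R by rewrite ltr0n card_gt0.
have lnE : ln (#|E|%:R : R) <= 2 * ln n%:R.
  have -> : 2 * ln n%:R = ln (n%:R ^+ 2) :> R by rewrite lnXn // mulr_natl.
  by rewrite ler_ln ?posrE ?exprn_gt0.
have lnE0 : 0 <= 1 + ln (#|E|%:R : R).
  by rewrite addr_ge0 // ln_ge0 // ler1n card_gt0.
apply: ler_pM => //; first by rewrite divr_ge0 ?ler0n // divr_ge0 // sqr_ge0.
  rewrite ler_wpM2l ?ler0n // invf_div ler_pM2l // dl2 expRN invrK.
  have -> : n%:R `^ (ln t ^+ 2 / t `^ p) = expR (ln t ^+ 2 / t `^ p * ln n%:R) :> R.
    by rewrite /powR gt_eqF.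
  have tp0 : 0 < t `^ p by rewrite powR_gt0.
  have TpE : Cc * t `^ p <= T `^ p.
    rewrite /T powRM ?(ltW t0) //; last by lra.
    by rewrite ler_pM2r // le1r_powR // ltW.
  have lnt : ln 2 <= ln t by rewrite ler_ln ?posrE.
  have qC : q <= Cc * ln t ^+ 2.
    apply: (@le_trans _ _ (Cc * ln 2 ^+ 2)).
      rewrite -ler_pdivrMr ?exprn_gt0 // /Cc; lra.
    by rewrite ler_pM2l ?lerXn2r ?nnegrE ?(ltW ln2) ?(le_trans (ltW ln2)) //; lra.
  rewrite ler_expR /x.
  have -> : 2 * (q * ln n%:R / (4 * T `^ p)) = q * ln n%:R / 2 / T `^ p.
    by field; rewrite gt_eqF.
  rewrite ler_pdivrMr //.
  apply: (@le_trans _ _ (ln t ^+ 2 / t `^ p * ln n%:R * (Cc * t `^ p))); last first.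
    rewrite ler_wpM2l // mulr_ge0 ?(ltW lnn) // divr_ge0 ?sqr_ge0 // ltW //.
  have -> : ln t ^+ 2 / t `^ p * ln n%:R * (Cc * t `^ p) = Cc * ln t ^+ 2 * ln n%:R.
    by field; rewrite gt_eqF.
  have : q * ln n%:R <= Cc * ln t ^+ 2 * ln n%:R by rewrite ler_pM2r.
  have : 0 < q * ln n%:R by rewrite mulr_gt0.
  lra.
by rewrite lerD2l.
Qed.

(** * Minkowski's inequality and the induced metric *)

Lemma powR_convex2 (R : realType) (p a b u v : R) : 1 <= p -> 0 <= a -> 0 <= b ->
  a + b = 1 -> 0 <= u -> 0 <= v ->
  (a * u + b * v) `^ p <= a * u `^ p + b * v `^ p.
Proof.
move=> p1 a0 b0 ab u0 v0; have a1 : a <= 1 by rewrite -ab lerDl.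
have dom z : 0 <= z -> z \in (`[0, +oo[%classic : set R).
  by move=> z0; apply: mem_set; rewrite /= in_itv /= z0.
have -> : b = 1 - a by rewrite -ab addrC addKr.
exact: (convex_powR p1 (Itv01 a0 a1) (dom u u0) (dom v v0)).
Qed.

Section LpMetric.
Variables (R : realType) (p : R) (D : nat).
Hypothesis p1 : 1 <= p.
Implicit Types x y : 'rV[R]_D.

Let p0 : 0 < p. Proof. exact: lt_le_trans p1. Qed.

Lemma lp_norm_eq0 x : lp_norm p x = 0 -> x = 0.
Proof.
move=> nx; have : lp_sum p x = 0 by rewrite -lp_norm_powR // nx powR0 // gt_eqF.
move/eqP; rewrite psumr_eq0 => [/allP h|i _]; last exact: powR_ge0.
apply/rowP => i; rewrite mxE; have /h : i \in index_enum 'I_D by rewrite mem_index_enum.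
by rewrite powR_eq0 normr_eq0 (gt_eqF p0) andbT => /eqP.
Qed.

Lemma lp_norm0 : lp_norm p (0 : 'rV[R]_D) = 0.
Proof.
rewrite /lp_norm big1 ?powR0 ?invr_eq0 ?gt_eqF // => i _.
by rewrite mxE normr0 powR0 // gt_eqF.
Qed.

Lemma lp_normN x : lp_norm p (- x) = lp_norm p x.
Proof.
by rewrite /lp_norm; congr (_ `^ _); apply: eq_bigr => i _; rewrite mxE normrN.
Qed.

(** With [a] and [b] the two norms, each coordinate [(|x_i| + |y_i|) / (a + b)] is the convex
    combination of [|x_i| / a] and [|y_i| / b] with weights [a / (a + b)] and [b / (a + b)].
    Convexity of the power bounds the sum of the p-th powers by 1. *)
Lemma lp_normD x y : lp_norm p (x + y) <= lp_norm p x + lp_norm p y.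
Proof.
have apn : lp_norm p x `^ p = lp_sum p x by rewrite lp_norm_powR.
have bpn : lp_norm p y `^ p = lp_sum p y by rewrite lp_norm_powR.
have a0 := lp_norm_ge0 p x; have b0 := lp_norm_ge0 p y.
have [ax|an] := eqVneq (lp_norm p x) 0.
  rewrite ax (lp_norm_eq0 ax) !add0r; exact: lexx.
have [bx|bn] := eqVneq (lp_norm p y) 0.
  rewrite bx (lp_norm_eq0 bx) !addr0; exact: lexx.
move: (lp_norm p x) (lp_norm p y) apn bpn a0 b0 an bn => a b apn bpn a0 b0 an bn.
have {an}ap : 0 < a by rewrite lt_def an.
have {bn}bp : 0 < b by rewrite lt_def bn.
have s0 : 0 < a + b by rewrite addr_gt0.
rewrite lp_norm_le ?(ltW s0) //.
have ap0 : 0 < a `^ p by rewrite powR_gt0.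
have bp0 : 0 < b `^ p by rewrite powR_gt0.
apply: (@le_trans _ _ (\sum_(i < D) (a + b) `^ p *
  (a / (a + b) * (`|x 0 i| `^ p / a `^ p) + b / (a + b) * (`|y 0 i| `^ p / b `^ p)))).
  apply: ler_sum => i _; rewrite mxE.
  apply: (@le_trans _ _ ((a + b) `^ p *
    (a / (a + b) * (`|x 0 i| / a) + b / (a + b) * (`|y 0 i| / b)) `^ p)).
    rewrite -powRM ?(ltW s0) //; last by rewrite addr_ge0 // mulr_ge0 // divr_ge0 // ltW.
    have -> : (a + b) * (a / (a + b) * (`|x 0 i| / a) + b / (a + b) * (`|y 0 i| / b)) =
        `|x 0 i| + `|y 0 i| by field; rewrite !gt_eqF.
    by rewrite ge0_ler_powR ?nnegrE ?addr_ge0 ?ler_normD // ltW.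
  rewrite ler_wpM2l ?powR_ge0 //.
  have divE z c : 0 <= z -> 0 < c -> z `^ p / c `^ p = (z / c) `^ p.
    move=> z0 c0; rewrite powRM ?invr_ge0 ?(ltW c0) //.
    by rewrite -[c^-1]powR_inv1 ?(ltW c0) // -powRrM mulN1r powRN.
  rewrite !divE //; apply: powR_convex2; rewrite ?divr_ge0 ?(ltW s0) //.
  by rewrite -mulrDl divff // gt_eqF.
rewrite -mulr_sumr big_split /= -!mulr_sumr -!mulr_suml.
rewrite -/(lp_sum p x) -/(lp_sum p y) -apn -bpn !divff ?gt_eqF // !mulr1.
by rewrite -mulrDl divff ?gt_eqF // mulr1.
Qed.

End LpMetric.

Section LpDist.
Variables (R : realType) (p : R) (D : nat) (X : {fset 'rV[R]_D}).
Hypothesis p1 : 1 <= p.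

Lemma lp_dist_pmetric : pmetric (@lp_dist R p D X).
Proof.
split.
- by move=> x; rewrite /lp_dist subrr lp_norm0.
- by move=> x y; rewrite /lp_dist -lp_normN opprB.
- move=> x y z; rewrite /lp_dist -[fsval x - fsval z](subrKA (fsval y)).
  exact: lp_normD.
Qed.

Lemma lp_dist_gt0 (x y : X) : x != y -> 0 < lp_dist p x y.
Proof.
move=> xy; rewrite lt_def lp_norm_ge0 andbT; apply: contra xy => /eqP.
by move/(lp_norm_eq0 p1)/eqP; rewrite subr_eq0 => /eqP/val_inj ->.
Qed.

End LpDist.

(** * Minimum spanning trees and light spanners *)

Section MinimumSpanningTree.
Variables (R : realType) (V : finType) (d : V -> V -> R).

Definition connected_graph (G : graph V) := forall x y : V, connect (adj G) x y.

Definition edge_code (G : graph V) : {ffun V * V -> bool} := [ffun p => adj G p.1 p.2].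

(** A [graph] carries proofs, so the minimum is taken over adjacency tables, which form a finite
    type. *)
Lemma exists_code_min (disp : Order.disp_t) (T : orderType disp) (P : graph V -> Prop)
    (w : {ffun V * V -> bool} -> T) : (exists G, P G) ->
  exists2 G, P G & forall G', P G' -> (w (edge_code G) <= w (edge_code G'))%O.
Proof.
case=> G0 PG0; pose Q := [pred c | `[< exists2 G, P G & edge_code G = c >]].
have Q0 : Q (edge_code G0) by apply/asboolP; exists G0.
case: (arg_minP w Q0) => c /asboolP[G PG <-] cmin; exists G => // G' PG'.
by apply: cmin; apply/asboolP; exists G'.
Qed.

Lemma complete_adj_sym : symmetric [rel x y : V | x != y].
Proof. by move=> x y; rewrite /= eq_sym. Qed.

Lemma complete_adj_irrefl : irreflexive [rel x y : V | x != y].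
Proof. by move=> x; rewrite /= eqxx. Qed.

Definition complete_graph := Graph complete_adj_sym complete_adj_irrefl.

Lemma complete_graph_connected : connected_graph complete_graph.
Proof.
move=> x y; have [->|xy] := eqVneq x y; first exact: connect0.
exact: connect1.
Qed.

Section RemoveEdge.
Variables (G : graph V) (a b : V).

Definition without_edge : rel V := [rel x y | adj G x y &&
  ~~ (((x == a) && (y == b)) || ((x == b) && (y == a)))].

Lemma without_edge_sym : symmetric without_edge.
Proof.
move=> x y; rewrite /without_edge /= adj_sym; congr (_ && ~~ _); rewrite orbC.
by rewrite andbC [(x == a) && _]andbC.
Qed.

Lemma without_edge_irrefl : irreflexive without_edge.
Proof. by move=> x; rewrite /without_edge /= adj_irrefl. Qed.

Definition remove_edge := Graph without_edge_sym without_edge_irrefl.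

End RemoveEdge.

(** A connected graph with fewest edges has no cycle of length 3 or more: its closing edge could be
    deleted, as the rest of the cycle still joins the ends. *)
Lemma exists_spanning_tree : exists G : graph V, spanning_tree G.
Proof.
have [G conG Gmin] := exists_code_min (fun c : {ffun V * V -> bool} => #|[set p | c p]|)
  (ex_intro _ _ complete_graph_connected).
exists G; split=> // c; rewrite leqNgt => /andP[cyc unc]; apply/negP => sz.
case: c cyc unc sz => [|x [|y [|z p]]] //= /and3P[exy eyz pth] /andP[xn /andP[yn _]] _.
pose l := last z p; pose G' := remove_edge G x l.
have lz : l \in z :: p by exact: mem_last.
have yl : y != l by apply: contraNneq yn => ->.
have xl : x != l.
  by apply: contraNneq xn => ->; rewrite inE lz orbT.
have exl : adj G l x by move: pth; rewrite rcons_path => /andP[].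
have pG' u q : path (adj G) u q -> x \notin u :: q -> path (adj G') u q.
  elim: q u => //= v q IH u /andP[euv pq]; rewrite !inE !negb_or => /and3P[xu xv xq].
  rewrite IH ?inE ?negb_or ?xv // andbT /without_edge /= euv /=.
  by rewrite eq_sym (negPf xu) /= [v == x]eq_sym (negPf xv) andbF.
have cxl : connect (adj G') x l.
  apply/connectP; exists (y :: z :: p) => //.
  rewrite -[path _ _ _]/(without_edge G x l x y && path (adj G') y (z :: p)).
  apply/andP; split.
    by rewrite /without_edge /= exy eqxx (negPf yl) (negPf xl).
  apply: pG' xn; rewrite /= eyz; move: pth; rewrite rcons_path.
  by case/andP.
have conG' : connected_graph G'.
  move=> u v; apply: connect_sub (conG u v) => u' v' e'.
  have [h|h] := boolP (((u' == x) && (v' == l)) || ((u' == l) && (v' == x))).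
    case/orP: h => /andP[/eqP -> /eqP ->] //.
    by rewrite (sym_connect_sym (@adj_sym _ G')).
  by apply: connect1; rewrite /= /without_edge /= e' h.
have := Gmin G' conG'; rewrite leEnat leqNgt => /negP; apply.
apply: proper_card; apply/properP; split.
  by apply/fintype.subsetP => q; rewrite !inE !ffunE /= => /andP[].
exists (l, x); rewrite !inE !ffunE /= ?exl //.
by rewrite /without_edge /= !eqxx orbT andbF.
Qed.

Lemma exists_mst : exists T : graph V, is_mst d T.
Proof.
pose w (c : {ffun V * V -> bool}) : R := (\sum_(x : V) \sum_(y : V | c (x, y)) d x y) / 2.
have wE G : w (edge_code G) = weight d G.
  rewrite /w /weight; congr (_ / _); apply: eq_bigr => x _; apply: eq_bigl => y.
  by rewrite ffunE.
have [T tT Tmin] := exists_code_min w exists_spanning_tree.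
by exists T; split=> // G /Tmin; rewrite !wE.
Qed.

End MinimumSpanningTree.

(** * Graphs from edge lists *)

Section EdgeGraph.
Variables (R : realType) (V : finType) (d : V -> V -> R) (L : seq (V * V)).
Hypothesis dm : pmetric d.

(** Loops are removed since [graph] is irreflexive; the stars used later list a loop at their
    centre. *)
Definition simple_edge_rel : rel V := [rel x y | (x != y) && edge_rel L x y].

Lemma simple_edge_rel_sym : symmetric simple_edge_rel.
Proof. by move=> x y; rewrite /simple_edge_rel /= eq_sym [edge_rel L x y]edge_rel_sym. Qed.

Lemma simple_edge_rel_irrefl : irreflexive simple_edge_rel.
Proof. by move=> x; rewrite /simple_edge_rel /= eqxx. Qed.

Definition edge_graph := Graph simple_edge_rel_sym simple_edge_rel_irrefl.

(** Only an inequality, as [L] may contain loops and repeat edges. Each orientation is bounded by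
    the whole list, and the factor 1/2 absorbs the two orientations. *)
Lemma edge_graph_weight : weight d edge_graph <= \sum_(p <- L) d p.1 p.2.
Proof.
have d0 x y : 0 <= d x y by exact: pmetric_ge0.
have [_ dC _] := dm; rewrite /weight ler_pdivrMr //.
have half : \sum_x \sum_(y | (x, y) \in L) d x y <= \sum_(p <- L) d p.1 p.2.
  rewrite pair_big_dep /= -big_filter.
  rewrite (eq_bigr (fun p => d p.1 p.2)) //.
  apply: (ler_sum_subseq (g := fun p => d p.1 p.2)) => //.
    by apply: filter_uniq; rewrite index_enum_uniq.
  by move=> p; rewrite mem_filter -surjective_pairing => /andP[].
apply: (@le_trans _ _ (\sum_x \sum_(y | (x, y) \in L) d x y +
    \sum_x \sum_(y | (y, x) \in L) d x y)).
  rewrite -big_split; apply: ler_sum => x _ /=.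
  rewrite big_mkcond [X in _ <= X + _]big_mkcond [X in _ <= _ + X]big_mkcond -big_split /=.
  apply: ler_sum => y _; rewrite /simple_edge_rel /edge_rel /=.
  by case: (x != y); case: (_ \in L); case: (_ \in L) => //=;
    rewrite ?addr0 ?add0r ?addr_ge0 ?lerDl ?d0 //.
rewrite mulr_natr mulr2n lerD // (exchange_big_dep xpredT) //=.
rewrite (eq_bigr (fun x => \sum_(y | (x, y) \in L) d x y)) // => x _.
by apply: eq_bigr => y _; exact: dC.
Qed.

Lemma edge_graph_dist x y : (forall x y, connect (edge_rel L) x y) ->
  (graph_dist d edge_graph x y <= (walk_dist d (edge_rel L) x y)%:E)%E.
Proof.
move=> con; have conG u v : connect (adj edge_graph) u v.
  apply: connect_sub (con u v) => u' v' e; have [->|ne] := eqVneq u' v'.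
    exact: connect0.
  by apply: connect1; rewrite /= /simple_edge_rel /= ne.
have := @graph_dist_le R V d dm (adj edge_graph) conG edge_graph x y.
move=> /(_ (fun u v h => h)) /le_trans; apply; rewrite lee_fin.
have [wxx _ wD] := walk_dist_pmetric dm simple_edge_rel_sym conG.
apply: lb_le_inf; first exact: walks_neq0.
move=> _ [s [ps <-] <-]; elim: s x ps => [|z s IH] x /=; first by rewrite wxx.
case/andP=> xz /IH le; apply: le_trans (wD x z _) (lerD _ le).
have [->|ne] := eqVneq x z; first by rewrite wxx pmetric_ge0.
by apply: walk_dist_edge => //; rewrite /= /simple_edge_rel /= ne.
Qed.

End EdgeGraph.

(** * Geometric scales, stars and the assembly of the spanner *)

Section Scales.
Variables (R : realFieldType) (th0 : R).
Hypothesis th0_gt0 : 0 < th0.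
Let th j := th0 * 33 ^+ j.

Let th_gt0 j : 0 < th j. Proof. by rewrite mulr_gt0 ?exprn_gt0. Qed.
Let thS j : th j.+1 = 33 * th j. Proof. by rewrite /th exprS mulrCA. Qed.

Lemma sum_scales m : \sum_(j < m.+1) th j <= 2 * th m.
Proof.
elim: m => [|m IH]; first by rewrite big_ord1; have := th_gt0 0; lra.
by rewrite big_ord_recr /= thS; have := th_gt0 m; lra.
Qed.

(** Bounds what an edge of length [l] costs over all the scales at which it counts as long. *)
Lemma sum_scales_below m l : 0 <= l ->
  \sum_(j < m) th j * (th j <= l)%R%:R <= 2 * l.
Proof.
move=> l0; elim: m => [|m IH]; first by rewrite big_ord0 mulr_ge0.
have [le|lt] := leP (th m) l; last first.
  by rewrite big_ord_recr /= [th m <= l]leNgt lt mulr0 addr0.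
apply: (@le_trans _ _ (\sum_(j < m.+1) th j)).
  by apply: ler_sum => j _; case: (th j <= l); rewrite ?mulr1 ?mulr0 // ltW.
by apply: le_trans (sum_scales m) _; rewrite ler_pM2l.
Qed.

End Scales.

Definition star_edges (V : finType) (C : {set V}) : seq (V * V) :=
  if [pick c in C] is Some c then [seq (c, z) | z <- enum C] else [::].

Lemma star_edges_weight (R : realFieldType) (V : finType) (d : V -> V -> R) (C : {set V}) r :
  (forall x y, x \in C -> y \in C -> d x y <= r) ->
  \sum_(p <- star_edges C) d p.1 p.2 <= #|C|%:R * r.
Proof.
move=> dr; rewrite /star_edges; case: pickP => [c cC|C0]; last first.
  by rewrite big_nil (eq_card0 C0) mul0r.
rewrite big_map big_enum /= mulr_natl -sumr_const.
by apply: ler_sum => z zC; exact: dr.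
Qed.

Lemma star_edges_center (V : finType) (C : {set V}) x : x \in C ->
  exists2 c, c \in C & forall y, y \in C -> (c, y) \in star_edges C.
Proof.
move=> xC; rewrite /star_edges; case: pickP => [c cC|/(_ x)]; last by rewrite xC.
by exists c => // y yC; apply: map_f; rewrite mem_enum.
Qed.

(** A pair of scale [th j <= 66 * d x y] that is not well served reaches the net in two moves of
    [16 * th j], and two star edges of length at most [33 * S * th j] join the net points. The stars
    weigh [33 * S * B] times the total [19 * wT] of the nets, and [wT] is twice the tree weight:
    1254 = 2 * 33 * 19. *)
Lemma light_spanner (R : realType) (V : finType) (d : V -> V -> R) (S B : R) :
  pmetric d -> (forall x y, x != y -> 0 < d x y) -> 1 <= S -> 0 <= B ->
  (forall (P : {set V}) (r : R), 0 < r -> exists Cs : seq {set V},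
    [/\ forall C, C \in Cs -> forall x y, x \in C -> y \in C -> d x y <= S * r,
        forall x y, x \in P -> y \in P -> d x y <= r ->
          exists2 C, C \in Cs & (x \in C) && (y \in C) &
        \sum_(C <- Cs) #|C|%:R <= #|P|%:R * B]) ->
  (1 < #|V|)%N -> exists H T : graph V,
  [/\ is_spanner d (66 * (32 + 66 * S)) H, is_mst d T, 0 < weight d T &
      weight d H <= (4 + 1254 * S * B) * weight d T].
Proof.
move=> dm dpos S1 B0 clusters.
case/card_gt1P=> rt [rt' [_ _ nrt]].
have [T mstT] := exists_mst d; have [[conT _] _] := mstT.
have [dxx dC dD] := dm; have d0 x y : 0 <= d x y by exact: pmetric_ge0.
pose ET := [seq q <- enum {: V * V} | adj T q.1 q.2].
pose wT := \sum_(q <- ET) d q.1 q.2.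
have wTE : wT = 2 * weight d T.
  rewrite /weight mulrC divfK // /wT big_filter big_enum_cond /=.
  by rewrite pair_big_dep.
have con x y : connect (edge_rel ET) x y.
  apply: connect_sub (conT x y) => u v uv; apply: connect1.
  by rewrite /edge_rel /= mem_filter mem_enum /= uv.
have diam x y : d x y <= 2 * wT.
  have [|||par [tT wg]] := @rooted_spanning_tree R V ET [set: V] rt; rewrite ?inE //.
    by move=> q; rewrite !inE.
  have toroot v : d v rt <= wT.
    have [_ _ _ conr] := tT.
    apply: le_trans (chain_dist tT dm _ (conr v _)) _; rewrite ?inE //.
    apply: le_trans (wg d dC d0); apply: ler_sum_sub => // z /and4P[-> _ zr nz].
    by rewrite nz.
  have := dD x rt y; have := toroot x; have := toroot y; rewrite (dC rt y).
  by clear; lra.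
have wT0 : 0 < wT.
  by have := diam rt rt'; have := dpos _ _ nrt; clear; lra.
(* The lowest scale [th0] will be below all positive distances, while the top scale [4 * wT] is
   twice the bound on the diameter; so every pair has its scale. *)
have [m mP] : exists m : nat, forall x y, x != y -> 4 * wT / 33 ^+ m < d x y.
  pose M := \sum_x \sum_(y | x != y) 4 * wT / d x y.
  have M0 : 0 <= M.
    by apply: sumr_ge0 => x _; apply: sumr_ge0 => y xy; rewrite !mulr_ge0 ?invr_ge0 // ltW.
  exists (Num.bound M) => x y xy; rewrite ltr_pdivrMr ?exprn_gt0 //.
  rewrite [ltRHS]mulrC -ltr_pdivrMr ?dpos //.
  apply: (@le_lt_trans _ _ M); last first.
    apply: lt_trans (archi_boundP M0) _; rewrite -natrX ltr_nat.
    exact: ltn_expl.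
  rewrite /M (bigD1 x) //= (bigD1 y) //= -addrA lerDl addr_ge0 //.
    by apply: sumr_ge0 => z /andP[xz _]; rewrite !mulr_ge0 ?invr_ge0 // ltW.
  apply: sumr_ge0 => z _; apply: sumr_ge0 => u zu.
  by rewrite !mulr_ge0 ?invr_ge0 // ltW.
pose th0 := 4 * wT / 33 ^+ m; pose th j := th0 * 33 ^+ j.
have th00 : 0 < th0 by rewrite divr_gt0 ?exprn_gt0 // mulr_gt0.
have th_gt0 j : 0 < th j by rewrite mulr_gt0 ?exprn_gt0.
have thS j : th j.+1 = 33 * th j by rewrite /th exprS mulrCA.
have thm : th m = 4 * wT by rewrite /th /th0 divfK // expf_neq0.
have [F [P [wF wP cov]]] := amortized_nets rt m.+1 dm con th00.
rewrite -/wT in wF wP.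
have /choice[Cs CsP] : forall j, exists Cs : seq {set V},
  [/\ forall C, C \in Cs -> forall x y, x \in C -> y \in C -> d x y <= S * (33 * th j),
      forall x y, x \in P j -> y \in P j -> d x y <= 33 * th j ->
        exists2 C, C \in Cs & (x \in C) && (y \in C) &
      \sum_(C <- Cs) #|C|%:R <= #|P j|%:R * B].
  by move=> j; apply: clusters; rewrite mulr_gt0.
pose stars := flatten [seq flatten [seq star_edges C | C <- Cs j] | j <- iota 0 m.+1].
pose L := (ET ++ F) ++ stars.
have conL x y : connect (edge_rel L) x y.
  apply: connect_sub (con x y) => u v uv; apply: connect1.
  by do 2!apply: edge_rel_catl.
pose dl := walk_dist d (edge_rel L).
have dlm : pmetric dl by apply: walk_dist_pmetric => //; exact: edge_rel_sym.
have [_ dlC dlD] := dlm.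
exists (edge_graph L), T; split=> //.
- move=> x y; apply: le_trans (edge_graph_dist dm x y conL) _; rewrite lee_fin -/dl.
  have [->|xy] := eqVneq x y; first by case: dlm => -> _ _; rewrite dxx mulr0.
  have exj : exists j, d x y <= th j / 2.
    by exists m; rewrite thm; have := diam x y; clear; lra.
  have [j dj jmin] := ex_minnP exj.
  have jm : (j < m.+1)%N.
    by rewrite ltnS; apply: jmin; rewrite thm; have := diam x y; clear; lra.
  (* For [j > 0] by minimality of [j], as consecutive scales have ratio 33; for [j = 0] by the
     choice of [m]. *)
  have thd : th j <= 66 * d x y.
    case: j dj jmin jm => [|j] dj jmin jm.
      have := mP x y xy; have := th_gt0 0; rewrite -/th0 /th expr0 mulr1; move: dj; lra.
    have : ~~ (d x y <= th j / 2) by apply: contraL (ltnSn j) => /jmin; rewrite -leqNgt.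
    by rewrite -ltNge thS; clear; lra.
  have dl_le u v : dl u v <= walk_dist d (edge_rel (ET ++ F)) u v.
    apply: walk_dist_mono => // [u' v'|u' v']; last exact: edge_rel_catl.
    by apply: connect_sub (con u' v') => ? ? ?; apply: connect1; exact: edge_rel_catl.
  have dxy0 := d0 x y.
  have [le|[q1 [q2 [q1P q2P dq1 dq2]]]] := cov j x y jm dj.
    apply: le_trans (dl_le x y) _; apply: le_trans le _; rewrite -/(th j).
    apply: (@le_trans _ _ (726 * d x y)); first by move: thd; clear; lra.
    by rewrite ler_wpM2r //; move: S1; clear; lra.
  rewrite -/(th j) in dq1 dq2.
  have led u v : d u v <= walk_dist d (edge_rel (ET ++ F)) u v.
    apply: le_walk_dist => // u' v'.
    by apply: connect_sub (con u' v') => ? ? ?; apply: connect1; exact: edge_rel_catl.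
  have dq : d q1 q2 <= 33 * th j.
    have := dD q1 x q2; have := dD x y q2; rewrite (dC q1 x).
    have := led x q1; have := led y q2; have := th_gt0 j.
    by move: dq1 dq2 dj; clear; lra.
  have [CsD CsC _] := CsP j.
  have [C CCs /andP[q1C q2C]] := CsC q1 q2 q1P q2P dq.
  have [c cC starC] := star_edges_center q1C.
  have inL z : z \in C -> dl c z <= S * (33 * th j).
    move=> zC; apply: le_trans (CsD C CCs c z cC zC).
    apply: walk_dist_edge => //; rewrite /edge_rel /= mem_cat; apply/orP; left.
    apply/orP; right; apply/flattenP; exists (flatten [seq star_edges C | C <- Cs j]).
      by apply/mapP; exists j => //; rewrite mem_iota.
    by apply/flattenP; exists (star_edges C); [exact: map_f|exact: starC].
  have i1 := inL q1 q1C; have i2 := inL q2 q2C.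
  have l1 := dl_le x q1; have l2 := dl_le y q2.
  have t1 := dlD x q1 y; have t2 := dlD q1 c y; have t3 := dlD c q2 y.
  rewrite (dlC q1 c) in t2; rewrite (dlC q2 y) in t3.
  have : (32 + 66 * S) * th j <= (32 + 66 * S) * (66 * d x y).
    by rewrite ler_wpM2l //; move: S1; clear; lra.
  have -> : (32 + 66 * S) * th j = 32 * th j + 2 * (S * (33 * th j)) by ring.
  move: i1 i2 l1 l2 t1 t2 t3 dq1 dq2; clear; lra.
- by move: wT0; rewrite wTE; clear; lra.
have S0 : 0 <= S := le_trans ler01 S1.
have wstars : \sum_(q <- stars) d q.1 q.2 <=
    33 * S * B * \sum_(j < m.+1) th j * #|P j|%:R.
  rewrite big_flatten big_map -[iota 0 _]/(index_iota 0 m.+1) big_mkord mulr_sumr.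
  apply: ler_sum => j _; have [CsD _ wC] := CsP j.
  rewrite big_flatten big_map.
  apply: (@le_trans _ _ (\sum_(C <- Cs j) #|C|%:R * (S * (33 * th j)))).
    rewrite big_seq [leRHS]big_seq; apply: ler_sum => C CCs.
    apply: star_edges_weight => x y xC yC; exact: (CsD C CCs x y xC yC).
  have SP : 0 <= S * (33 * th j).
    by rewrite !mulr_ge0 // ltW.
  rewrite -mulr_suml; have := ler_wpM2r SP wC; move/le_trans; apply.
  by rewrite le_eqVlt; apply/orP; left; apply/eqP; ring.
(* 19 = 3 + 8 + 4 * 2: the tree weight, the sum of the scales, and the long edges of the tree. *)
have wnets : \sum_(j < m.+1) th j * #|P j|%:R <= 19 * wT.
  apply: le_trans wP _.
  have s1 : \sum_(j < m.+1) th j <= 8 * wT.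
    by have := sum_scales th00 m; rewrite -/th -/(th m) thm; clear; lra.
  have s2 : \sum_(j < m.+1) th j * (count (fun p => th j <= d p.1 p.2)%R ET)%:R <= 2 * wT.
    rewrite /wT mulr_sumr.
    apply: (@le_trans _ _ (\sum_(q <- ET) \sum_(j < m.+1) th j * (th j <= d q.1 q.2)%R%:R)).
      rewrite exchange_big /=; apply: ler_sum => j _.
      rewrite -mulr_sumr ler_pM2l // -sum1_count natr_sum big_mkcond /=.
      by apply: ler_sum => q _; case: ifP.
    by apply: ler_sum => q _; exact: sum_scales_below.
  pose N j : R := (count (fun p => th j <= d p.1 p.2)%R ET)%:R.
  have -> : \sum_(j < m.+1) th j * (1 + 4 * N j) =
      \sum_(j < m.+1) th j + 4 * \sum_(j < m.+1) th j * N j.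
    by rewrite mulr_sumr -big_split /=; apply: eq_bigr => j _; ring.
  by move: s1 s2; clear; lra.
apply: le_trans (edge_graph_weight L dm) _.
have -> : \sum_(q <- L) d q.1 q.2 =
    wT + \sum_(q <- F) d q.1 q.2 + \sum_(q <- stars) d q.1 q.2.
  by rewrite 2!big_cat.
have SB : 0 <= 33 * S * B by rewrite !mulr_ge0.
have := ler_wpM2l SB wnets.
have -> : (4 + 1254 * S * B) * weight d T = 2 * wT + 33 * S * B * (19 * wT).
  by rewrite wTE; ring.
by move: wF wstars; clear; lra.
Qed.

(** * Spaces of at most one point and the final constants *)

Lemma is_spanner_le (R : realType) (V : finType) (d : V -> V -> R) (s t : R) (G : graph V) :
  (forall x y, 0 <= d x y) -> s <= t -> is_spanner d s G -> is_spanner d t G.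
Proof.
move=> d0 st sG x y; apply: le_trans (sG x y) _.
by rewrite lee_fin ler_wpM2r.
Qed.

Lemma subsingleton_spanner (R : realType) (V : finType) (d : V -> V -> R) (t : R) (G : graph V) :
  (#|V| <= 1)%N -> (forall x y, 0 <= d x y) -> 0 <= t -> is_spanner d t G /\ weight d G = 0.
Proof.
move=> V1 d0 t0; have eqV (x y : V) : x = y by apply: (fintype_le1P V1).
split=> [x y|].
  apply: (@le_trans _ _ 0%E); last by rewrite lee_fin mulr_ge0.
  by apply: ereal_inf_lbound; exists [::] => //; split=> //=; exact: eqV.
rewrite /weight big1 ?mul0r // => x _; rewrite big1 // => y.
by rewrite (eqV y x) adj_irrefl.
Qed.

Theorem theorem1p6 (R : realType) :
  exists C1 C2 : R, [/\ 0 < C1, 0 < C2 &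
    forall (p : R) (n D : nat) (X : {fset 'rV[R]_D}) (t : R),
      1 < p -> p <= 2 -> #|` X| = n -> 2 <= t ->
      exists H T : graph X,
        [/\ is_spanner (@lp_dist R p D X) (C1 * t) H,
            is_mst (@lp_dist R p D X) T &
            weight (@lp_dist R p D X) H / weight (@lp_dist R p D X) T
              <= C2 * (t * n%:R `^ (ln t ^+ 2 / t `^ p) * ln n%:R)]].
Proof.
have [Cc Cc1 clusters] := lp_clusters R.
have ln2 : 0 < ln 2 :> R by rewrite ln_gt0 // ltr1n.
have Cc0 : 0 < Cc by exact: lt_le_trans Cc1.
have l0 : 0 < (ln 2)^-1 :> R by rewrite invr_gt0.
exists (66 * (32 + 66 * Cc)), (4 / ln 2 + 5016 * Cc * ((ln 2)^-1 + 2)); split.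
- by move: Cc0; clear; lra.
- have : 0 < Cc * ((ln 2)^-1 + 2) by rewrite mulr_gt0 ?addr_gt0.
  by move: l0; clear; lra.
move=> p n D X t p1 p2 Xn t2.
have t0 : 0 < t by exact: lt_le_trans t2.
have dm := @lp_dist_pmetric R p D X (ltW p1).
have d0 x y : 0 <= @lp_dist R p D X x y by exact: pmetric_ge0.
have nu0 : 0 <= ln t ^+ 2 / t `^ p by rewrite divr_ge0 ?powR_ge0 ?sqr_ge0.
(* With at most one point both sides vanish: the weight of the graph is 0, and so is [ln n%:R]. *)
have [n1|n2] := leqP n 1.
  have X1 : (#|{: X}| <= 1)%N by rewrite -cardfE Xn.
  have [T mstT] := exists_mst (@lp_dist R p D X).
  have [|spT wT] := @subsingleton_spanner _ _ _ (66 * (32 + 66 * Cc) * t) T X1 d0.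
    by move: t0 (mulr_gt0 Cc0 t0); clear; lra.
  exists T, T; split=> //; rewrite wT mul0r.
  have -> : ln n%:R = 0 :> R by case: (n) n1 => [|[]] // _; rewrite ?ln1 ?ln0.
  by rewrite !mulr0.
have nR : 2 <= n%:R :> R by rewrite ler_nat.
have n0 : 0 < n%:R :> R by exact: lt_le_trans nR.
have lnn : ln 2 <= ln n%:R :> R by rewrite ler_ln ?posrE.
have a1 : 1 <= n%:R `^ (ln t ^+ 2 / t `^ p).
  by rewrite -[leLHS](powRr0 n%:R) ler_powR ?ler1n ?(ltn_trans _ n2).
set a := n%:R `^ _ in a1 *; set L := ln n%:R in lnn *.
have L0 : 0 <= L by exact: le_trans (ltW ln2) lnn.
have [|||||H [T [spH mstT wT wH]]] :=
    @light_spanner R X (@lp_dist R p D X) (Cc * t) (4 * a * (1 + 2 * L)) dm.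
- by move=> x y; apply: lp_dist_gt0; exact: ltW.
- by rewrite -[leLHS]mulr1 ler_pM // (le_trans _ t2) // ler1n.
- by rewrite !mulr_ge0 ?addr_ge0 ?mulr_ge0 // (le_trans ler01).
- move=> P r r0; have Pn : (#|P| <= n)%N by rewrite -Xn cardfE max_card.
  have [Cs [CsD CsC wC]] := clusters p t r n D X (@fsval _ X) P p1 p2 t2 r0 n2 Pn.
  exists Cs; split=> //; last by rewrite mulrA.
  by move=> C /CsD[].
- by rewrite -cardfE Xn.
exists H, T; split=> //.
  apply: is_spanner_le spH => //; have : 0 <= t - 1 by move: t2; clear; lra.
  by move: t0; clear; lra.
rewrite ler_pdivrMr //; apply: le_trans wH _; rewrite ler_pM2r //.
(* For [n >= 2] the additive constants are absorbed into the factor [t * a * L] at the price of a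
   division by [ln 2]. *)
have Ll : 1 <= L / ln 2 by rewrite ler_pdivlMr // mul1r.
have ta : 1 <= t * a by rewrite -[leLHS]mulr1 ler_pM // (le_trans _ t2) // ler1n.
have taL : 1 <= t * a * (L / ln 2) by rewrite -[leLHS]mulr1 ler_pM.
have : Cc * (t * a) * (1 + 2 * L) <= Cc * (t * a) * (L / ln 2 + 2 * L).
  by rewrite ler_wpM2l ?lerD2r // mulr_ge0 ?(ltW Cc0) // (le_trans ler01).
have -> : (4 / ln 2 + 5016 * Cc * ((ln 2)^-1 + 2)) * (t * a * L) =
  4 * (t * a * (L / ln 2)) + 5016 * (Cc * (t * a) * (L / ln 2 + 2 * L)) by ring.
have -> : 1254 * (Cc * t) * (4 * a * (1 + 2 * L)) =
  5016 * (Cc * (t * a) * (1 + 2 * L)) by ring.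
by move: taL; clear; lra.
Qed.
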